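(* Consider the 2D network with the LOS-association-only path-loss model and let $\tau>0$. The SINR coverage $\mathrm{p_c}(\tau)$ decreases with an increase in blockage correlation: if two blockage environments have the same $\beta$ and their joint LoS probabilities satisfy $p^{(1)}_{\mathsf L,\mathsf L}\le p^{(2)}_{\mathsf L,\mathsf L}$ pointwise, then the corresponding coverages satisfy $\mathrm{p_c}^{(1)}(\tau)\ge \mathrm{p_c}^{(2)}(\tau)$. Moreover $$\underline{\mathrm{p_c}}(\tau)\le \mathrm{p_c}(\tau)\le\overline{\mathrm{p_c}}(\tau),$$ where $\overline{\mathrm{p_c}}(\tau)$ and $\underline{\mathrm{p_c}}(\tau)$ are the values of the SINR coverage under independent blocking and in the maximally correlated case, respectively, given by $$\overline{\mathrm{p_c}}(\tau)=\int_0^\infty2\pi\lambda\,e^{-\tau\sigma_n^2/\ell_{\mathsf L}(r)}\,\overline{\kappa}(r,\tau)\,\overline{g}(r)\,r\,dr,\qquad \underline{\mathrm{p_c}}(\tau)=\int_0^\infty2\pi\lambda\,e^{-\tau\sigma_n^2/\ell_{\mathsf L}(r)}\,\underline{\kappa}(r,\tau)\,\underline{g}(r)\,r\,dr,$$ with $$\overline g(r)=\exp\Big(-\beta r-\frac{2\pi\lambda}{\beta^2}\big(1-(1+\beta r)e^{-\beta r}\big)\Big),\qquad \overline\kappa(r,\tau)=\exp\Big(-\int_r^\infty\frac{2\pi\lambda e^{-\beta t}}{1+\tau^{-1}\ell_{\mathsf L}(r)/\ell_{\mathsf L}(t)}\,t\,dt\Big),$$ $$\underline g(r)=e^{-\beta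 r}\exp\Big(-4\lambda\int_0^r\int_0^{\pi/2}t\,e^{-\beta t\sin^2\theta}\,d\theta\,dt\Big),\qquad \underline\kappa(r,\tau)=\exp\Big(-2\pi e^{\beta r/2}\,\mathsf I_0(\beta r/2)\int_r^\infty\frac{\lambda e^{-\beta t}}{1+\tau^{-1}\ell_{\mathsf L}(r)/\ell_{\mathsf L}(t)}\,t\,dt\Big).$$
   Context: 2D network. Base stations form a homogeneous Poisson point process (PPP) of density $\lambda>0$ on $\mathbb R^2$; the typical user is at the origin. Blockages form an independent Boolean model of line segments: centers form a homogeneous PPP of density $\mu>0$, with i.i.d. random lengths $L$ ($0<\mathbb E[L]<\infty$) and independent orientations uniform on $[0,\pi]$; $\beta=2\mu\mathbb E[L]/\pi$. A link of length $r$ from the origin is LoS if no blockage intersects it, with probability $p_{\mathsf L}(r)=e^{-\beta r}$. For two links from the origin of lengths $r_1,r_2$ with directions differing by $\theta\in[0,2\pi]$, $p_{\mathsf L,\mathsf L}(r_1,r_2,\theta)$ is the probability that no blockage intersects either of them. Independent blocking means that $p_{\mathsf L,\mathsf L}(r_1,r_2,\theta)$ is replaced by $e^{-\beta r_1-\beta r_2}$. The maximally correlated case (blockages tending to infinite length with $\beta$ fixed) means that $p_{\mathsf L,\mathsf L}(r_1,r_2,\theta)$ is replaced by the upper bound $\exp\big(-\beta r_1-\beta r_2+\tfrac12\min(r_1,r_2)\beta(1+\cos\theta)\big)$. LOS-association-only path-loss (LAP) model: NLoS power $\ell_{\mathsf N}\equiv0$; LoS power $\ell_{\mathsf L}:[0,\infty)\to(0,\infty)$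 bounded and nonincreasing. $\sigma_n^2>0$ is the noise power. Under the paper's first-order correlation model (only correlation between the serving link and each interfering link is kept), with i.i.d. mean-one exponential fading and association to the BS of largest average received power, the SINR coverage in this model is $$\mathrm{p_c}(\tau)=\int_0^\infty2\pi\lambda\,e^{-\tau\sigma_n^2/\ell_{\mathsf L}(r)}\,\kappa_{\mathsf L|\mathsf L}(r,\tau)\,g_{\mathsf L}(r)\,r\,dr,$$ $$g_{\mathsf L}(x)=p_{\mathsf L}(x)\exp\Big(-\lambda\int_0^{2\pi}\int_0^x\frac{p_{\mathsf L,\mathsf L}(x,t,\theta)}{p_{\mathsf L}(x)}t\,dt\,d\theta\Big),\quad \kappa_{\mathsf L|\mathsf L}(r,\tau)=\exp\Big(-\int_r^\infty\frac{\lambda}{1+\tau^{-1}\ell_{\mathsf L}(r)/\ell_{\mathsf L}(t)}\int_0^{2\pi}\frac{p_{\mathsf L,\mathsf L}(r,t,\theta)}{p_{\mathsf L}(r)}d\theta\,t\,dt\Big).$$ $\mathsf I_0$ is the modified Bessel function of the first kind of order $0$. *)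

(* Defs.v *)
From HB Require Import structures.
From mathcomp Require Import all_boot all_order all_algebra.
From mathcomp Require Import all_classical all_reals all_analysis.

Set Implicit Arguments.
Unset Strict Implicit.
Unset Printing Implicit Defensive.

Import Order.TTheory GRing.Theory Num.Theory.
Import numFieldNormedType.Exports.

Local Open Scope classical_set_scope.
Local Open Scope ring_scope.

Section point_processes.
Context (R : realType) (d d' : measure_display) (Omega : measurableType d)
  (P : probability Omega R) (T : measurableType d').

(* Points are counted with multiplicity: N B w = #{i | X i w \in B}. *)
Definition npoints (X : nat -> {RV P >-> T}) (B : set T) (w : Omega) : \bar R :=
  counting [set i | B (X i w)].

(* Void for sets of infinite intensity, whose number of points is then almost
   surely infinite by countable additivity.  The library's [poisson_pmf] is not
   used because it is constantly 1 at rate 0; here 0 ^+ 0 = 1. *)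
Definition is_poisson_process (nu : set T -> \bar R) (X : nat -> {RV P >-> T}) :=
  forall (n : nat) (B : 'I_n -> set T) (k : 'I_n -> nat),
    (forall j, measurable (B j)) ->
    (forall j, (nu (B j) < +oo)%E) ->
    trivIset setT B ->
    P [set w | forall j, npoints X (B j) w = ((k j)%:R)%:E] =
    (\prod_(j < n) (fine (nu (B j)) ^+ k j / (k j)`!%:R
                    * expR (- fine (nu (B j)))))%:E.

End point_processes.

Section blockages.
Variable R : realType.
Implicit Types (r th len : R) (c : R * R).

Definition area : set (R * R) -> \bar R :=
  (@lebesgue_measure R \x @lebesgue_measure R)%E.

Definition link r th : set (R * R) :=
  [set z | exists2 t, 0 <= t <= r & z = (t * cos th, t * sin th)].

Definition blockage c len th : set (R * R) :=
  [set z | exists2 s, - (len / 2) <= s <= len / 2 &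
                      z = (c.1 + s * cos th, c.2 + s * sin th)].

(* A Boolean model of segments: the centers form a Poisson process of density
   [mu], independent of the marks, which are mutually independent. The
   independence is the product rule on the cylinder events, a pi-system
   generating the sigma-algebras of the centers and of the marks. *)
Record boolean_model := BooleanModel {
  bm_disp : measure_display;
  bm_space : measurableType bm_disp;
  bm_prob : probability bm_space R;
  bm_mu : R;
  bm_center : nat -> {RV bm_prob >-> (R * R)%type};
  bm_length : nat -> {RV bm_prob >-> R};
  bm_angle : nat -> {RV bm_prob >-> R};
  bm_mu_gt0 : 0 < bm_mu;
  bm_centerP : is_poisson_process (fun B => bm_mu%:E * area B)%E bm_center;
  bm_length_ge0 : forall i w, 0 <= bm_length i w;
  bm_length_id : forall i (B : set R), measurable B ->
    distribution bm_prob (bm_length i) B = distribution bm_prob (bm_length 0%N) B;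
  bm_length_mean : (0 < 'E_bm_prob[bm_length 0%N] < +oo)%E;
  bm_angle_unif : forall i (B : set R), measurable B ->
    distribution bm_prob (bm_angle i) B = uniform_prob (pi_gt0 R) B;
  bm_indep : forall (n : nat) (A : 'I_n -> set (R * R)) (B C : 'I_n -> set R),
    (forall i, measurable (A i)) ->
    (forall i, measurable (B i)) ->
    (forall i, measurable (C i)) ->
    bm_prob [set w | forall i : 'I_n, [/\ A i (bm_center i w),
                       B i (bm_length i w) & C i (bm_angle i w)]] =
    (bm_prob [set w | forall i : 'I_n, A i (bm_center i w)] *
     \prod_(i < n) (bm_prob (bm_length i @^-1` B i) *
                    bm_prob (bm_angle i @^-1` C i)))%E
}.

Implicit Type E : boolean_model.

Definition bm_beta E : R :=
  2 * bm_mu E * fine ('E_(bm_prob E)[bm_length E 0%N])%E / pi.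

Definition los E r th : set (bm_space E) :=
  [set w | forall i,
     link r th `&` blockage (bm_center E i w) (bm_length E i w) (bm_angle E i w)
     = set0].
Arguments los : clear implicits.

(* By isotropy, (one of) the link(s) is put on the positive x-axis. *)
Definition los_prob E r : R := fine (bm_prob E (los E r 0)).

Definition joint_los_prob E r1 r2 th : R :=
  fine (bm_prob E (los E r1 0 `&` los E r2 th)).

End blockages.

Section coverage.
Variable R : realType.
Local Notation leb := (@lebesgue_measure R).
Local Open Scope ereal_scope.

(* I_0(x) = sum_k (x/2)^(2k) / (k!)^2. *)
Definition bessel_I0 (x : R) : R :=
  limn (series (fun k => ((x / 2) ^+ (2 * k) / (k`!%:R ^+ 2))%R)).

(* [lam]: base station density; [noise]: noise power; [ell]: LoS power;
   [pL], [pLL]: LoS and joint LoS probabilities.  Only the correlation between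
   the serving link and each interfering link is kept.  The exponents are
   extended reals, so that a divergent integral gives [expeR -oo = 0]. *)
Definition serving_g (lam : R) (pL : R -> R) (pLL : R -> R -> R -> R) (x : R)
    : \bar R :=
  (pL x)%:E *
  expeR (- (lam%:E * \int[leb]_(th in `[0%R, (2 * pi)%R])
                       \int[leb]_(t in `[0%R, x]) (pLL x t th / pL x * t)%:E)).

Definition interf_kappa (lam : R) (ell : R -> R) (pL : R -> R)
    (pLL : R -> R -> R -> R) (r tau : R) : \bar R :=
  expeR (- \int[leb]_(t in `[r, +oo[)
     ((lam / (1 + tau^-1 * (ell r / ell t)))%:E *
      (\int[leb]_(th in `[0%R, (2 * pi)%R]) (pLL r t th / pL r)%:E) * t%:E)).

Definition coverage_integral (lam noise : R) (ell : R -> R) (tau : R)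
    (kappa g : R -> \bar R) : \bar R :=
  \int[leb]_(r in `[0%R, +oo[)
    ((2 * pi * lam * expR (- (tau * noise / ell r)))%:E *
     kappa r * g r * r%:E).

Definition coverage (lam noise : R) (ell : R -> R) (pL : R -> R)
    (pLL : R -> R -> R -> R) (tau : R) : \bar R :=
  coverage_integral lam noise ell tau
    (interf_kappa lam ell pL pLL ^~ tau) (serving_g lam pL pLL).

Definition network_coverage (lam noise : R) (ell : R -> R)
    (E : boolean_model R) (tau : R) : \bar R :=
  coverage lam noise ell (los_prob E) (joint_los_prob E) tau.

Definition indep_joint_los (beta r1 r2 th : R) : R :=
  expR (- (beta * r1) - beta * r2).

Definition maxcorr_joint_los (beta r1 r2 th : R) : R :=
  expR (- (beta * r1) - beta * r2
        + 2^-1 * Num.min r1 r2 * beta * (1 + cos th)).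

Definition g_upper (lam beta r : R) : \bar R :=
  (expR (- (beta * r) - 2 * pi * lam / beta ^+ 2
                        * (1 - (1 + beta * r) * expR (- (beta * r)))))%:E.

Definition kappa_upper (lam beta : R) (ell : R -> R) (r tau : R) : \bar R :=
  expeR (- \int[leb]_(t in `[r, +oo[)
     (2 * pi * lam * expR (- (beta * t)) / (1 + tau^-1 * (ell r / ell t))
      * t)%:E).

Definition g_lower (lam beta r : R) : \bar R :=
  (expR (- (beta * r)))%:E *
  expeR (- ((4 * lam)%:E * \int[leb]_(t in `[0%R, r])
     \int[leb]_(th in `[0%R, (pi / 2)%R])
       (t * expR (- (beta * t * sin th ^+ 2)))%:E)).

Definition kappa_lower (lam beta : R) (ell : R -> R) (r tau : R) : \bar R :=
  expeR (- ((2 * pi * expR (beta * r / 2) * bessel_I0 (beta * r / 2))%:E *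
     \int[leb]_(t in `[r, +oo[)
       (lam * expR (- (beta * t)) / (1 + tau^-1 * (ell r / ell t)) * t)%:E)).

Definition coverage_upper (lam noise beta : R) (ell : R -> R) (tau : R) :=
  coverage_integral lam noise ell tau
    (kappa_upper lam beta ell ^~ tau) (g_upper lam beta).

Definition coverage_lower (lam noise beta : R) (ell : R -> R) (tau : R) :=
  coverage_integral lam noise ell tau
    (kappa_lower lam beta ell ^~ tau) (g_lower lam beta).

End coverage.

(* Main.v *)
(** Averaging over the independent marks turns the probability that no blockage
    meets the links into the probability generating functional of the Poisson
    process of centers, hence into [exp (- mu * E |A|)] where [A] is the set of
    centers whose segment meets a link. For one link [A] is a parallelogram of
    area [L r |sin phi|]. For two links [joint = exp (- mu * E |A1 u A2|)]; the
    overlap [A1 n A2] has nonnegative area and is contained in either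
    parallelogram, and it is negligible unless the two links lie on the same
    side of the direction of the blockage, so that its mean area is at most
    [E L min(r1, r2) (1 + cos theta) / pi]. This gives the independent and the
    maximally correlated bounds. The coverage is antitone in the joint LoS
    probability; its extreme values follow by Fubini and from
    [int_0^(2 pi) exp(z cos theta) dtheta = 2 pi I_0(z)]. *)

From HB Require Import structures.
Require Import Defs.
From mathcomp Require Import all_boot all_order all_algebra.
From mathcomp Require Import all_classical all_reals all_analysis.
From mathcomp Require Import measurable_realfun ring lra.

Set Implicit Arguments.
Unset Strict Implicit.
Unset Printing Implicit Defensive.

Import Order.TTheory GRing.Theory Num.Theory.
Import numFieldNormedType.Exports.

Local Open Scope classical_set_scope.
Local Open Scope ring_scope.

(** * Independent marks *)

(** The points come as a sequence whose terms may depend on each other in any way: a Poisson process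
    is described only through its counts in disjoint sets of finite intensity, and the independence
    of the marks only through cylinder events of the first n points. Hence every statement about all
    blockages is the limit of one about the first n. For simple functions the limit follows from the
    joint law of the counts. A general function needs two limits, in n and in the approximation;
    they can be exchanged because the approximation error is bounded, uniformly in n, by the mean
    number of points, that is, by an integral against the intensity.

    In the geometry, a shear along the direction of the blockage makes all segments vertical: areas
    become products of two lengths, and two links on opposite sides get shadows on opposite
    half-lines. The factor 1 + cos theta is the integral of a sine over the orientations that leave
    both links on the same side, and 1/pi is the density of the orientation. *)

Definition image_measure (R : realType) (d d' : measure_display)
  (T : measurableType d) (T' : measurableType d') (m : {measure set T -> \bar R})
  (f : T -> T') (mf : measurable_fun setT f) : {measure set T' -> \bar R} :=
  measure_function_pushforward__canonical__measure_function_Measure m mf.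

Section rectangles.
Context (R : realType) (d1 d2 : measure_display) (T1 : measurableType d1)
  (T2 : measurableType d2).

Lemma rect_measure_unique (m m' : {measure set (T1 * T2) -> \bar R}) :
  (m setT < +oo)%E ->
  (forall A B, measurable A -> measurable B -> m (A `*` B) = m' (A `*` B)) ->
  forall X, measurable X -> m X = m' X.
Proof.
move=> moo mm' X mX.
apply: (measure_unique [set A `*` B | A in measurable & B in measurable]
  (fun=> setT)) => //.
- exact: measurable_prod_measurableType.
- move=> _ _ [A mA [B mB <-]] [A' mA' [B' mB' <-]]; rewrite -setXI.
  by exists (A `&` A'); [exact: measurableI|exists (B `&` B') => //;
     exact: measurableI].
- by move=> _; exists setT => //; exists setT => //; rewrite setXTT.
- by rewrite bigcup_const//; exists 0%N.
- by move=> _ [A mA [B mB <-]]; exact: mm'.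
Qed.

End rectangles.

Section boxes.
Context (R : realType) (d1 d2 d3 : measure_display) (T1 : measurableType d1)
  (T2 : measurableType d2) (T3 : measurableType d3).

Definition box : set (set (T1 * (T2 * T3))) :=
  [set X | exists A B C, [/\ measurable A, measurable B, measurable C &
                              X = A `*` (B `*` C)]].

(** Uniqueness on rectangles is used twice. For a fixed first side [A], restricting to [A] times the
    whole space and projecting gives two finite measures on the last two factors, which rectangles
    determine. *)
Lemma box_measure_unique (m m' : {measure set (T1 * (T2 * T3)) -> \bar R}) :
  (m setT < +oo)%E -> (forall X, box X -> m X = m' X) ->
  forall X, measurable X -> m X = m' X.
Proof.
move=> moo mm'; apply: rect_measure_unique => // A D mA.
have mAT : measurable (A `*` [set: T2 * T3]) by exact: measurableX.
have msnd : measurable_fun setT (@snd T1 (T2 * T3)) by exact: measurable_snd.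
pose n := image_measure (mrestr m mAT) msnd.
pose n' := image_measure (mrestr m' mAT) msnd.
have E (X : set (T2 * T3)) : (@snd T1 (T2 * T3)) @^-1` X `&` (A `*` setT) = A `*` X.
  by apply/seteqP; split=> -[a b] /=; rewrite /setX /=; tauto.
suff : forall D, measurable D -> n D = n' D.
  by move=> /[apply]; rewrite /n /n' /= /pushforward /mrestr E.
apply: rect_measure_unique.
  rewrite /n /= /pushforward /mrestr E; apply: le_lt_trans moo.
  by apply: le_measure; rewrite ?inE.
move=> B C mB mC; rewrite /n /n' /= /pushforward /mrestr E.
by apply: mm'; exists A, B, C.
Qed.

End boxes.

Section replace.
Context (S V : Type) (n : nat).

Definition replace (G : 'I_n -> S) (i : 'I_n) (B : S) : 'I_n -> S :=
  fun j => if j == i then B else G j.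

Lemma replace_id G i : replace G i (G i) = G.
Proof. by apply/funext => j; rewrite /replace; case: eqP => // ->. Qed.

(* The coordinates are freed from [Pi] one after the other. *)
Lemma slotwise_eq (M Pi : set S) (F F' : ('I_n -> S) -> V) :
  Pi `<=` M ->
  (forall G, (forall i, Pi (G i)) -> F G = F' G) ->
  (forall i G, (forall j, M (G j)) ->
     (forall B, Pi B -> F (replace G i B) = F' (replace G i B)) ->
     F G = F' G) ->
  forall G, (forall i, M (G i)) -> F G = F' G.
Proof.
move=> PiM FPi Fstep.
(* [m] counts the slots already free: those below [m] range over [M], the others still over [Pi]. *)
suff H m G : (forall i, M (G i)) -> (forall i : 'I_n, (m <= i)%N -> Pi (G i)) ->
    F G = F' G.
  by move=> G MG; apply: (H n) => // i; rewrite leqNgt ltn_ord.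
elim: m G => [|m IH] G MG PiG; first by apply: FPi => i; exact: PiG.
have [mn|nm] := ltnP m n; last first.
  by apply: IH => // i /leq_ltn_trans/(_ (ltn_ord i)); rewrite ltnNge nm.
apply: (Fstep (Ordinal mn)) => // B PiB; apply: IH => i; rewrite /replace.
  by case: ifP => // _; exact: PiM.
case: eqP => //= im mi; apply: PiG; rewrite ltn_neqAle mi andbT.
by apply/eqP => mi'; apply: im; exact/val_inj.
Qed.

End replace.

Section marked_law.
Context (R : realType) (d d1 d2 : measure_display) (Omega : measurableType d)
  (T : measurableType d1) (M : measurableType d2) (P : probability Omega R).
Variables (nu : {sigma_finite_measure set M -> \bar R}) (X : {mfun Omega >-> T})
  (h : Omega -> R).
Hypotheses (h0 : forall w, 0 <= h w) (mh : measurable_fun [set: Omega] h).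
Local Open Scope ereal_scope.

(** The mean in [marking] as a function of the set in a single slot, the factors of the other slots
    being collected in the weight [h]. Its being a measure is what allows uniqueness on boxes. *)
Definition marked_law (B : set (T * M)) : \bar R :=
  \int[P]_w ((h w)%:E * nu (xsection B (X w))).

Let marked0 : marked_law set0 = 0.
Proof. by rewrite /marked_law integral0_eq// => w _; rewrite xsection0 measure0 mule0. Qed.

Let marked_ge0 B : 0 <= marked_law B.
Proof. by apply: integral_ge0 => w _; rewrite mule_ge0 ?lee_fin. Qed.

Lemma measurable_xsection_comp (B : set (T * M)) : measurable B ->
  measurable_fun setT (fun w => nu (xsection B (X w))).
Proof.
move=> mB; apply: (measurableT_comp (measurable_fun_xsection nu mB)).
exact: measurable_funPT.
Qed.

Let marked_sigma_additive : semi_sigma_additive marked_law.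
Proof.
move=> F mF tF mUF.
rewrite [X in _ --> X](_ : _ = \sum_(n <oo) marked_law (F n)).
  by apply/cvg_closeP; split; [exact: is_cvg_nneseries|rewrite closeE].
rewrite -integral_nneseries//; last first.
- by move=> n w _; rewrite mule_ge0 ?lee_fin.
- by move=> n; apply: emeasurable_funM; [exact/measurable_EFinP|
  exact: measurable_xsection_comp].
apply: eq_integral => w _.
rewrite xsection_bigcup nneseriesZl//; congr (_ * _).
apply/esym/cvg_lim => //=.
apply: (measure_sigma_additive _ (trivIset_xsection tF)) => i.
exact: measurable_xsection.
Qed.

HB.instance Definition _ := isMeasure.Build _ _ _ marked_law
  marked0 marked_ge0 marked_sigma_additive.

Definition marked_lawM := [the {measure set (T * M) -> \bar R} of marked_law].

End marked_law.

Section marking.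
Context (R : realType) (d d1 d2 d3 : measure_display) (Omega : measurableType d)
  (T : measurableType d1) (M1 : measurableType d2) (M2 : measurableType d3)
  (P : probability Omega R).
Variables (X : nat -> {mfun Omega >-> T}) (Y : nat -> {mfun Omega >-> M1})
  (Z : nat -> {mfun Omega >-> M2}).
Variable nu : probability (M1 * M2)%type R.
Hypothesis indep : forall (n : nat) (A : 'I_n -> set T) (B : 'I_n -> set M1)
    (C : 'I_n -> set M2),
  (forall i, measurable (A i)) -> (forall i, measurable (B i)) ->
  (forall i, measurable (C i)) ->
  P [set w | forall i : 'I_n, [/\ A i (X i w), B i (Y i w) & C i (Z i w)]] =
  (P [set w | forall i : 'I_n, A i (X i w)] * \prod_(i < n) nu (B i `*` C i))%E.
Local Notation mark := (M1 * M2)%type.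

Definition mark_prob (G : set (T * mark)) (x : T) : R := fine (nu (xsection G x)).

Lemma mark_probE G x : measurable G -> (mark_prob G x)%:E = nu (xsection G x).
Proof.
by move=> mG; rewrite /mark_prob fineK// fin_num_measure//; exact: measurable_xsection.
Qed.

Lemma mark_prob_itv G x : measurable G -> 0 <= mark_prob G x <= 1.
Proof.
move=> mG; rewrite -!lee_fin mark_probE// measure_ge0/=.
by apply: probability_le1; exact: measurable_xsection.
Qed.

Lemma measurable_mark_prob G : measurable G -> measurable_fun setT (mark_prob G).
Proof.
by move=> mG; apply: measurableT_comp => //; exact: measurable_fun_xsection.
Qed.

Let pt (i : nat) (w : Omega) : T * mark := (X i w, (Y i w, Z i w)).

Let mpt i : measurable_fun setT (pt i).
Proof. by apply: measurable_fun_pair => //; apply: measurable_fun_pair. Qed.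

Lemma measurable_marked_event (n : nat) (G : 'I_n -> set (T * mark)) :
  (forall i, measurable (G i)) ->
  measurable [set w | forall i : 'I_n, G i (pt i w)].
Proof.
move=> mG.
rewrite (_ : [set _ | _] = \bigcap_(i in [set: 'I_n]) (pt i @^-1` G i)); last first.
  by apply/seteqP; split=> w /= H; [move=> i _; exact: H|move=> i; exact: H].
apply: fin_bigcap_measurable => // i _.
by rewrite -[X in measurable X]setTI; exact: mpt.
Qed.

(** The marks are integrated out while the points stay inside the integral, since nothing is known
    about their joint law. On boxes this is the independence hypothesis; in each slot both sides are
    finite measures, so it extends one slot at a time. *)
Lemma marking (n : nat) (G : 'I_n -> set (T * mark)) :
  (forall i, measurable (G i)) ->
  P [set w | forall i : 'I_n, G i (pt i w)] =
  (\int[P]_w (\prod_(i < n) mark_prob (G i) (X i w))%:E)%E.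
Proof.
pose F G := P [set w | forall i : 'I_n, G i (pt i w)].
pose F' G := (\int[P]_w (\prod_(i < n) mark_prob (G i) (X i w))%:E)%E.
move: G; apply: (@slotwise_eq _ _ n measurable (@box _ _ _ T M1 M2) F F').
- by move=> _ [A [B [C [mA mB mC ->]]]]; apply: measurableX => //; exact: measurableX.
- move=> G boxG.
  have /choice[A HA] : forall i, exists A, exists B C, [/\ measurable A, measurable B,
      measurable C & G i = A `*` (B `*` C)] by [].
  have /choice[B HB] := HA.
  have /choice[C HC] := HB.
  rewrite /F [X in P X](_ : _ = [set w | forall i : 'I_n,
      [/\ A i (X i w), B i (Y i w) & C i (Z i w)]]); last first.
    apply/seteqP; split=> w /= H i; have [_ _ _ E] := HC i; have := H i; rewrite E.
      by case=> /= ? [].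
    by case.
  rewrite indep; last 3 first.
  + by move=> i; have [] := HC i.
  + by move=> i; have [] := HC i.
  + by move=> i; have [] := HC i.
  set EA := [set w | forall i : 'I_n, A i (X i w)].
  have mEA : measurable EA.
    rewrite (_ : EA = [set w | forall i : 'I_n, (A i `*` setT) (pt i w)]).
      apply: (@measurable_marked_event n (fun i => A i `*` setT)) => i; apply: measurableX => //.
      by have [] := HC i.
    by apply/seteqP; split=> w /= H i; have := H i => //; case.
  rewrite /F' (eq_integral (fun w => (\1_EA w)%:E *
      \prod_(i < n) nu (B i `*` C i))%E); last first.
    move=> w _; rewrite -prodEFin.
    rewrite indicE; have [|] := boolP (w \in EA).
      rewrite inE => wEA; rewrite mul1e; apply: eq_bigr => i _.
      have [mA mB mC E] := HC i.
      rewrite mark_probE; last by rewrite E; apply: measurableX => //; exact: measurableX.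
      by rewrite E in_xsectionX// inE; exact: wEA.
    rewrite notin_setE mul0e => /existsNP[i Ai].
    have [mA mB mC E] := HC i.
    rewrite (bigD1 i)//= mark_probE; last first.
      by rewrite E; apply: measurableX => //; exact: measurableX.
    by rewrite E notin_xsectionX ?measure0 ?mul0e// notin_setE.
  rewrite ge0_integralZr//; last 2 first.
  + by apply/measurable_EFinP; exact: measurable_indic.
  + by elim/big_ind: _ => // x y; exact: mule_ge0.
  by rewrite integral_indic// setIT.
- move=> i G mG FF'.
  (* With [setT] in slot [i], [E] is the event imposed by the other slots. Restricting [P] to it and
     taking the image under point [i] gives the left side as a measure. *)
  pose E := [set w | forall j : 'I_n, (replace G i setT) j (pt j w)].
  have mE : measurable E.
    by apply: measurable_marked_event => j; rewrite /replace; case: ifP.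
  pose h w := \prod_(j < n | j != i) mark_prob (G j) (X j w).
  have h0 w : 0 <= h w.
    by apply: prodr_ge0 => j _; have /andP[] := mark_prob_itv (X j w) (mG j).
  have mh : measurable_fun [set: Omega] h.
    rewrite /h; under eq_fun do rewrite -big_filter.
    apply: measurable_prod => j _.
    apply: measurableT_comp; first exact: measurable_mark_prob.
    exact: measurable_funPT.
  pose m := image_measure (mrestr P mE) (mpt i).
  pose m' := marked_lawM P nu (X i) h0 mh.
  have mF B : m B = F (replace G i B).
    rewrite /m /F /= /pushforward /mrestr; congr (P _).
    apply/seteqP; split=> w /=.
      move=> [Bw Ew] j; have := Ew j; rewrite /replace; case: eqP => [-> _|//]; exact: Bw.
    move=> H; split; first by have := H i; rewrite /replace eqxx.
    by move=> j; have := H j; rewrite /replace; case: eqP.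
  have mF' B : measurable B -> m' B = F' (replace G i B).
    move=> mB; rewrite /m' /F' /= /marked_law; apply: eq_integral => w _.
    rewrite (bigD1 i)//= {1}/replace eqxx EFinM mark_probE// muleC; congr (_ * _%:E)%E.
    by apply: eq_bigr => j ji; rewrite /replace (negbTE ji).
  rewrite -(replace_id G i) -mF -mF'//.
  apply: box_measure_unique => //.
    rewrite mF; apply: (@le_lt_trans _ _ 1%E); last exact: ltry.
    apply: probability_le1; apply: measurable_marked_event => j.
    by rewrite /replace; case: ifP.
  move=> B boxB; rewrite mF mF'; first exact: FF'.
  case: boxB => A [C [D [mA mC mD ->]]].
  by apply: measurableX => //; exact: measurableX.
Qed.

End marking.

(** * Counts of a Poisson process *)

Section poisson_series.
Context (R : realType).
Implicit Types x : R.
Local Open Scope ereal_scope.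

Lemma nneseries_expR x : (0 <= x)%R ->
  \sum_(k <oo) (x ^+ k / k`!%:R)%:E = (expR x)%:E.
Proof.
move=> x0; rewrite /expR -EFin_lim; last exact: is_cvg_series_exp_coeff.
by apply: congr_lim; apply/funext => n /=; rewrite -sumEFin.
Qed.

Lemma nneseries_expR_mean x : (0 <= x)%R ->
  \sum_(k <oo) (k%:R * (x ^+ k / k`!%:R))%:E = (x * expR x)%:E.
Proof.
move=> x0.
have h0 k : 0 <= (k%:R * (x ^+ k / k`!%:R))%:E.
  by rewrite lee_fin mulr_ge0// divr_ge0// exprn_ge0.
rewrite nneseries_recl// mul0r add0e.
rewrite -[LHS](@nneseries_addn _ (fun k => (k%:R * (x ^+ k / k`!%:R))%:E) 1)//.
rewrite EFinM -nneseries_expR//  -nneseriesZl; last first.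
  by move=> i _; rewrite lee_fin divr_ge0// exprn_ge0.
apply: eq_eseriesr => k _; rewrite -EFinM; congr (_%:E).
rewrite addn1 factS exprS natrM; field.
by rewrite pnatr_eq0 -lt0n fact_gt0/= addrC natr1 pnatr_eq0.
Qed.

End poisson_series.

Section counts.
Context (R : realType) (d d' : measure_display) (Omega : measurableType d)
  (P : probability Omega R) (T : measurableType d').
Variable X : nat -> {RV P >-> T}.
Local Open Scope ereal_scope.
Implicit Type B : set T.

Lemma npointsE B w : npoints X B w = \sum_(i <oo) (\1_B (X i w))%:E.
Proof.
rewrite /npoints counting_dirac; apply: eq_eseriesr => i _.
by rewrite diracE indicE; congr (_%:R%:E); apply: congr1; apply/idP/idP; rewrite !inE.
Qed.

Let mindX B i : measurable B -> measurable_fun setT (fun w => (\1_B (X i w) : R)%:E).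
Proof.
move=> mB; apply/measurable_EFinP; apply: measurableT_comp => //.
Qed.

Lemma measurable_npoints B : measurable B -> measurable_fun setT (npoints X B).
Proof.
move=> mB; rewrite (funext (npointsE B)).
by apply: ge0_emeasurable_sum => i w _; rewrite ?lee_fin//; exact: mindX.
Qed.

Lemma mean_npoints B : measurable B ->
  \int[P]_w npoints X B w = \sum_(i <oo) P (X i @^-1` B).
Proof.
move=> mB; under eq_integral do rewrite npointsE.
rewrite integral_nneseries//; last by move=> i; exact: mindX.
apply: eq_eseriesr => i _.
by rewrite integral_indic// ?setIT// -[X in measurable X]setTI; exact: measurable_funPT.
Qed.

Definition has_npoints B (k : nat) : set Omega :=
  [set w | npoints X B w = k%:R%:E].

Lemma measurable_has_npoints B k : measurable B -> measurable (has_npoints B k).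
Proof.
move=> mB; rewrite -[X in measurable X]setTI.
exact: (measurable_npoints mB measurableT (emeasurable_set1 k%:R%:E)).
Qed.

Lemma trivIset_has_npoints B : trivIset setT (has_npoints B).
Proof.
apply/trivIsetP => i j _ _ ij; apply/seteqP; split => // w [Ni Nj].
by have [/eqP] := etrans (esym Ni) Nj; rewrite eqr_nat (negbTE ij).
Qed.

Definition finitely_many B : set Omega := \bigcup_k has_npoints B k.

Lemma measurable_finitely_many B : measurable B -> measurable (finitely_many B).
Proof. by move=> mB; apply: bigcupT_measurable => k; exact: measurable_has_npoints. Qed.

Lemma nneseries_has_npoints B (a : nat -> R) k w : (forall i, 0 <= a i)%R ->
  has_npoints B k w ->
  \sum_(i <oo) (a i)%:E * (\1_(has_npoints B i) w)%:E = (a k)%:E.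
Proof.
move=> a0 Bkw; rewrite (@nneseriesD1 _ _ k xpredT)//=; last first.
  by move=> i _; rewrite mule_ge0// lee_fin.
rewrite eseries0 ?adde0; last first.
  move=> i _ ik; rewrite indicE memNset ?mule0//.
  have /trivIsetP/(_ i k I I ik)/seteqP[+ _] := @trivIset_has_npoints B.
  by move=> /(_ w) H Biw; exact: H.
by rewrite indicE mem_set// mule1.
Qed.

(* [a N] for the number [N] of points in [B], and 0 if [N] is infinite. *)
Definition fun_npoints (a : nat -> R) B w : R :=
  fine (\sum_(k <oo) (a k)%:E * (\1_(has_npoints B k) w)%:E).

Lemma fun_npoints_fin (a : nat -> R) B k w : (forall i, 0 <= a i)%R ->
  has_npoints B k w -> fun_npoints a B w = a k.
Proof. by move=> a0 Bkw; rewrite /fun_npoints (nneseries_has_npoints a0 Bkw). Qed.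

Lemma fun_npoints_inf (a : nat -> R) B w :
  ~ finitely_many B w -> fun_npoints a B w = 0%R.
Proof.
move=> Bw; rewrite /fun_npoints eseries0// => i _ _.
by rewrite indicE memNset ?mule0// => Biw; apply: Bw; exists i.
Qed.

Lemma fun_npointsE (a : nat -> R) B w : (forall i, 0 <= a i)%R ->
  (fun_npoints a B w)%:E = \sum_(k <oo) (a k)%:E * (\1_(has_npoints B k) w)%:E.
Proof.
move=> a0; rewrite /fun_npoints.
have [[k _ Bkw]|Bw] := pselect (finitely_many B w).
  by rewrite (nneseries_has_npoints a0 Bkw).
rewrite eseries0// => i _ _.
by rewrite indicE memNset ?mule0// => Biw; apply: Bw; exists i.
Qed.

Lemma fun_npoints_ge0 (a : nat -> R) B w : (forall i, 0 <= a i)%R ->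
  (0 <= fun_npoints a B w)%R.
Proof.
move=> a0; rewrite -lee_fin fun_npointsE//.
by apply: nneseries_ge0 => i _ _; rewrite mule_ge0// lee_fin.
Qed.

Lemma measurable_fun_npoints (a : nat -> R) B : (forall i, 0 <= a i)%R ->
  measurable B -> measurable_fun setT (fun_npoints a B).
Proof.
move=> a0 mB; apply/measurable_EFinP.
rewrite (_ : EFin \o _ =
  fun w => \sum_(k <oo) (a k)%:E * (\1_(has_npoints B k) w)%:E); last first.
  by apply/funext => w /=; exact: fun_npointsE.
apply: ge0_emeasurable_sum => i w _; first by rewrite mule_ge0// lee_fin.
apply: emeasurable_funM => //; apply/measurable_EFinP.
by apply: measurable_indic; exact: measurable_has_npoints.
Qed.

(** Single counts are the case in which the definition of a Poisson process yields the mean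
    directly; they start the extension in [joint_poisson_mean]. *)
Lemma fun_npoints_delta B k w :
  fun_npoints (fun i => (i == k)%:R) B w = \1_(has_npoints B k) w.
Proof.
have a0 i : (0 <= (i == k)%:R :> R)%R by [].
have [[j _ Bjw]|Bw] := pselect (finitely_many B w).
  rewrite (fun_npoints_fin a0 Bjw) indicE.
  have [jk|jk] := eqVneq j k; first by rewrite mem_set// -jk.
  rewrite memNset//.
  have /trivIsetP/(_ j k I I jk)/seteqP[+ _] := @trivIset_has_npoints B.
  by move=> /(_ w) H Biw; exact: H.
by rewrite fun_npoints_inf// indicE memNset// => Biw; apply: Bw; exists k.
Qed.

End counts.

Section poisson_counts.
Context (R : realType) (d d' : measure_display) (Omega : measurableType d)
  (P : probability Omega R) (T : measurableType d').
Variables (X : nat -> {RV P >-> T}) (nu : {measure set T -> \bar R}).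
Hypothesis XP : is_poisson_process nu X.
Local Open Scope ereal_scope.
Implicit Type B : set T.

Definition poisson_rate B (k : nat) : R :=
  (fine (nu B) ^+ k / k`!%:R * expR (- fine (nu B)))%R.

Lemma poisson_rate_ge0 B k : (0 <= poisson_rate B k)%R.
Proof.
by rewrite mulr_ge0// ?expR_ge0// divr_ge0// exprn_ge0// fine_ge0.
Qed.

(** The generating function of the Poisson law, summed as an exponential series in [b * v]. *)
Lemma poisson_rate_sum (b : R) B : (0 <= b)%R ->
  \sum_(k <oo) (b ^+ k * poisson_rate B k)%:E =
  (expR (- ((1 - b) * fine (nu B))))%:E.
Proof.
move=> b0; set v := fine (nu B).
have v0 : (0 <= v)%R by rewrite fine_ge0.
rewrite (eq_eseriesr (g := fun k => (expR (- v))%:E * ((b * v) ^+ k / k`!%:R)%:E)).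
  rewrite nneseriesZl; last first.
    by move=> i _; rewrite lee_fin divr_ge0// exprn_ge0// mulr_ge0.
  by rewrite nneseries_expR ?mulr_ge0// -EFinM -expRD; congr (expR _)%:E; ring.
move=> k _; rewrite -EFinM /poisson_rate -/v exprMn; congr (_%:E); ring.
Qed.

Lemma poisson_rate_sum1 B : \sum_(k <oo) (poisson_rate B k)%:E = 1.
Proof.
have := poisson_rate_sum B (@ler01 R); rewrite subrr mul0r oppr0 expR0 => <-.
by apply: eq_eseriesr => k _; rewrite expr1n mul1r.
Qed.

Definition poisson_mean (a : nat -> R) B : R :=
  fine (\sum_(k <oo) (a k * poisson_rate B k)%:E).

Lemma poisson_meanE (a : nat -> R) B : (forall k, 0 <= a k <= 1)%R ->
  (poisson_mean a B)%:E = \sum_(k <oo) (a k * poisson_rate B k)%:E.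
Proof.
move=> a01; rewrite /poisson_mean fineK//.
have h k : 0 <= (a k * poisson_rate B k)%:E.
  by rewrite lee_fin mulr_ge0 ?poisson_rate_ge0//; have /andP[] := a01 k.
rewrite ge0_fin_numE; last by apply: nneseries_ge0.
apply: (@le_lt_trans _ _ 1); last exact: ltry.
rewrite -(poisson_rate_sum1 B); apply: lee_nneseries => // k _.
by rewrite lee_fin ler_piMl ?poisson_rate_ge0//; have /andP[] := a01 k.
Qed.

Lemma poisson_mean_delta k B :
  poisson_mean (fun i => (i == k)%:R) B = poisson_rate B k.
Proof.
apply: EFin_inj; rewrite poisson_meanE; last by move=> i; case: eqP; rewrite ?lexx ?ler01.
rewrite (@nneseriesD1 _ _ k xpredT)//=; last first.
  by move=> i _; rewrite lee_fin mulr_ge0 ?poisson_rate_ge0.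
rewrite eqxx mul1r eseries0 ?adde0// => i _ ik.
by rewrite (negbTE ik) mul0r.
Qed.

(** Independence of the counts, passed from events to means. When every [a j] is the indicator of
    one value, this is the definition of the process; then one slot at a time is expanded as a
    nonnegative series of such indicators and integrated term by term. *)
Lemma joint_poisson_mean n (B : 'I_n -> set T) (a : 'I_n -> nat -> R) :
  (forall j, measurable (B j)) -> (forall j, nu (B j) < +oo) ->
  trivIset setT B ->
  (forall j k, 0 <= a j k <= 1)%R ->
  \int[P]_w (\prod_(j < n) fun_npoints X (a j) (B j) w)%:E =
  (\prod_(j < n) poisson_mean (a j) (B j))%:E.
Proof.
move=> mB Boo tB.
pose F a := \int[P]_w (\prod_(j < n) fun_npoints X (a j) (B j) w)%:E.
pose F' (a : 'I_n -> nat -> R) := (\prod_(j < n) poisson_mean (a j) (B j))%:E.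
move: a; apply: (@slotwise_eq _ _ n [set a | forall k, 0 <= a k <= 1]%R
  (range (fun k : nat => fun i => (i == k)%:R)) F F').
- by move=> _ [k _ <-] i /=; case: eqP; rewrite ?lexx ?ler01.
- move=> a /(_ _)/cid2 ka.
  have {ka}/choice[k ka] : forall j, exists k, a j = fun i => (i == k)%:R.
    by move=> j; have [k _ <-] := ka j; exists k.
  rewrite /F /F' (funext ka).
  under [in RHS]eq_bigr do rewrite poisson_mean_delta.
  rewrite -XP//.
  under eq_integral do under eq_bigr do rewrite fun_npoints_delta.
  set E := [set w | _].
  have mE : measurable E.
    rewrite (_ : E = \bigcap_(j in [set: 'I_n]) has_npoints X (B j) (k j)).
      by apply: fin_bigcap_measurable => // j _; exact: measurable_has_npoints.
    by apply/seteqP; split=> w H j //=; [move=> _|]; exact: H.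
  rewrite -[E in RHS](setIT) -integral_indic//; apply: eq_integral => w _.
  rewrite indicE; congr (_%:E).
  have [wE|wE] := boolP (w \in E).
    rewrite big1// => j _; rewrite indicE mem_set//; move: wE; rewrite inE; exact.
  move: wE; rewrite notin_setE => /existsNP[j Bj].
  by rewrite (bigD1 j)//= indicE memNset ?mul0r.
- move=> i a a01 FF'.
  have a0 j k : (0 <= a j k)%R by have /andP[] := a01 j k.
  pose h w := (\prod_(j < n | j != i) fun_npoints X (a j) (B j) w)%R.
  have h0 w : (0 <= h w)%R by apply: prodr_ge0 => j _; exact: fun_npoints_ge0.
  have mh : measurable_fun [set: Omega] h.
    rewrite /h; under eq_fun do rewrite -big_filter.
    by apply: measurable_prod => j _; exact: measurable_fun_npoints.
  pose Q := (\prod_(j < n | j != i) poisson_mean (a j) (B j))%R.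
  have FE b : F (replace a i b) =
      \int[P]_w ((h w)%:E * (fun_npoints X b (B i) w)%:E).
    apply: eq_integral => w _.
    rewrite (bigD1 i)//= {1}/replace eqxx mulrC EFinM; congr (_%:E * _).
    by apply: eq_bigr => j ji; rewrite /replace (negbTE ji).
  have F'E b : F' (replace a i b) = (Q * poisson_mean b (B i))%:E.
    rewrite /F' (bigD1 i)//= {1}/replace eqxx mulrC; congr (_ * _)%:E.
    by apply: eq_bigr => j ji; rewrite /replace (negbTE ji).
  have Fk k : \int[P]_w ((h w)%:E * (\1_(has_npoints X (B i) k) w)%:E) =
      Q%:E * (poisson_rate (B i) k)%:E.
    rewrite -EFinM -poisson_mean_delta -F'E -FF'; last by exists k.
    by rewrite FE; apply: eq_integral => w _; rewrite fun_npoints_delta.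
  have mi k : measurable_fun [set: Omega]
      (fun w => (h w)%:E * (\1_(has_npoints X (B i) k) w)%:E).
    apply: emeasurable_funM; apply/measurable_EFinP => //.
    by apply: measurable_indic; exact: measurable_has_npoints.
  have hi0 k w : 0 <= (h w)%:E * (\1_(has_npoints X (B i) k) w)%:E.
    by rewrite mule_ge0// lee_fin.
  rewrite -(replace_id a i) FE F'E EFinM poisson_meanE; last exact: a01.
  under eq_integral => w _.
    rewrite fun_npointsE// -nneseriesZl; last first.
      by move=> k _; rewrite mule_ge0// lee_fin.
    under eq_eseriesr do rewrite muleCA.
    over.
  rewrite integral_nneseries//; last 2 first.
  + by move=> k; apply: emeasurable_funM => //; exact: measurable_cst.
  + by move=> k w _; rewrite mule_ge0// lee_fin.
  rewrite -nneseriesZl; last first.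
    by move=> k _; rewrite lee_fin mulr_ge0// poisson_rate_ge0.
  apply: eq_eseriesr => k _.
  by rewrite ge0_integralZl ?lee_fin// Fk EFinM muleCA.
Qed.

End poisson_counts.

Section poisson_intensity.
Context (R : realType) (d d' : measure_display) (Omega : measurableType d)
  (P : probability Omega R) (T : measurableType d').
Variables (X : nat -> {RV P >-> T}) (nu : {measure set T -> \bar R}).
Hypothesis XP : is_poisson_process nu X.
Local Open Scope ereal_scope.
Implicit Type B : set T.

Lemma prob_has_npoints B k : measurable B -> nu B < +oo ->
  P (has_npoints X B k) = (poisson_rate nu B k)%:E.
Proof.
move=> mB Boo; have := @XP 1%N (fun=> B) (fun=> k) (fun=> mB) (fun=> Boo).
rewrite big_ord1 => <-.
  by congr (P _); apply/seteqP; split=> w; [move=> Bw _|move/(_ ord0)].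
by apply/trivIsetP => i j _ _; rewrite !ord1 eqxx.
Qed.

Lemma prob_finitely_many B : measurable B -> nu B < +oo -> P (finitely_many X B) = 1.
Proof.
move=> mB Boo; rewrite /finitely_many measure_bigcup//; last 2 first.
- by move=> k _; exact: measurable_has_npoints.
- exact: trivIset_has_npoints.
rewrite -(poisson_rate_sum1 nu B) (eq_eseriesl (Q := xpredT)); last first.
  by move=> k; rewrite in_setT.
by apply: eq_eseriesr => k _; exact: prob_has_npoints.
Qed.

Lemma ae_finitely_many B : measurable B -> nu B < +oo ->
  {ae P, forall w, finitely_many X B w}.
Proof.
move=> mB Boo; have mF := @measurable_finitely_many _ _ _ _ P _ X B mB.
apply/negligibleP; first exact: measurableC.
have -> : ~` [set w | finitely_many X B w] = ~` finitely_many X B by [].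
by apply: etrans (probability_setC P mF) _; rewrite prob_finitely_many// subee.
Qed.

(** Both sides are the mean number of points in [B]. The count is almost surely finite, hence almost
    everywhere the series of k times the indicator of k points, whose mean is that of a Poisson
    law. *)
Lemma intensity_poisson B : measurable B -> nu B < +oo ->
  \sum_(i <oo) P (X i @^-1` B) = nu B.
Proof.
move=> mB Boo; rewrite -mean_npoints//.
pose S w := \sum_(k <oo) (k%:R : R)%:E * (\1_(has_npoints X B k) w)%:E.
have S0 k w : 0 <= (k%:R : R)%:E * (\1_(has_npoints X B k) w)%:E by rewrite mule_ge0// lee_fin.
have mS k : measurable_fun [set: Omega] (fun w => (k%:R : R)%:E * (\1_(has_npoints X B k) w)%:E).
  apply: emeasurable_funM => //; apply/measurable_EFinP.
  by apply: measurable_indic; exact: measurable_has_npoints.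
rewrite (ge0_ae_eq_integral (g := S))//; last 4 first.
- exact: measurable_npoints.
- exact: ge0_emeasurable_sum.
- by move=> w _; exact: nneseries_ge0.
- have := ae_finitely_many mB Boo; apply: filterS => w [k _ Bkw] _.
  by rewrite /S (nneseries_has_npoints (a := fun k => k%:R) _ Bkw).
rewrite integral_nneseries//.
under eq_eseriesr => k _.
  rewrite ge0_integralZl//; last first.
    apply/measurable_EFinP.
    by apply: measurable_indic; exact: measurable_has_npoints.
  rewrite integral_indic//; last exact: measurable_has_npoints.
  rewrite setIT [X in _ * X](prob_has_npoints k mB Boo).
  rewrite -EFinM /poisson_rate mulrA mulrC EFinM.
  over.
rewrite nneseriesZl; last first.
  by move=> k _; rewrite lee_fin mulr_ge0// divr_ge0// exprn_ge0// fine_ge0.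
rewrite nneseries_expR_mean ?fine_ge0// -EFinM mulrCA -expRD addNr expR0 mulr1.
by rewrite fineK// ge0_fin_numE.
Qed.

(** The sum of the laws of the points is a measure that agrees with [nu] on sets of finite
    intensity. Elsewhere [nu] is infinite and the inequality is trivial, so no sigma-finiteness is
    called for. *)
Lemma campbell_le (h : T -> R) : measurable_fun setT h -> (forall x, 0 <= h x)%R ->
  \sum_(i <oo) \int[P]_w (h (X i w))%:E <= \int[nu]_x (h x)%:E.
Proof.
move=> mh h0.
pose m i := image_measure P (@measurable_funPT _ _ _ _ (X i)).
have mEh : measurable_fun [set: T] (EFin \o h) by exact/measurable_EFinP.
rewrite [leLHS](_ : _ = \int[mseries m 0]_x (h x)%:E); last first.
  rewrite ge0_integral_measure_series//; last by move=> x _; rewrite lee_fin.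
  apply: eq_eseriesr => i _; symmetry.
  rewrite [LHS](ge0_integral_pushforward _ P measurableT mEh)/= ?preimage_setT//.
  by move=> x _; rewrite /= lee_fin.
apply: ge0_le_measure_integral => // B mB.
have [Boo|] := ltP (nu B) +oo; last by rewrite leye_eq => /eqP ->; rewrite leey.
by rewrite -[leRHS]intensity_poisson.
Qed.

End poisson_intensity.

(** * Probability generating functional *)

Section pgfl.
Context (R : realType) (d d' : measure_display) (Omega : measurableType d)
  (P : probability Omega R) (T : measurableType d').
Variable X : nat -> {RV P >-> T}.
Implicit Types (f g : T -> R) (B : set T).

Lemma prod_count (b : R) B n w :
  \prod_(i < n) (1 - b * \1_B (X i w)) =
  (1 - b) ^+ \sum_(i < n) (X i w \in B).
Proof.
elim: n => [|n IH]; first by rewrite !big_ord0.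
rewrite !big_ord_recr /= IH exprD indicE; congr (_ * _).
by case: (_ \in _); rewrite ?mulr1 ?mulr0 ?subr0.
Qed.

Lemma cvg_prod_count (b : R) B k w : has_npoints X B k w ->
  \prod_(i < n) (1 - b * \1_B (X i w)) @[n --> \oo] --> (1 - b) ^+ k.
Proof.
rewrite /has_npoints/= npointsE => Bkw.
pose c n := (\sum_(i < n) (X i w \in B))%N.
have ck : (c n)%:R @[n --> \oo] --> (k%:R : R).
  suff : ((c n)%:R : R)%:E @[n --> \oo] --> (k%:R : R)%:E by move/fine_cvg.
  rewrite -Bkw [X in X @ _ --> _](_ : _ =
      fun n => \sum_(0 <= i < n) ((\1_B (X i w) : R)%:E))%E.
    by apply: is_cvg_nneseries => i _ _; rewrite lee_fin.
  apply/funext => n; rewrite /c natr_sum -sumEFin big_mkord.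
  by apply: eq_bigr => i _; rewrite indicE.
apply: cvg_near_cst.
(* The partial counts are natural numbers: at distance less than 1 from [k] they equal [k], so the
   sequence is eventually constant. *)
move/cvgrPdist_lt : ck => /(_ 1 ltr01); apply: filterS => n.
rewrite prod_count -/(c n) ltr_norml => /andP[ck1 ck2]; congr (_ ^+ _).
apply/eqP; rewrite eqn_leq -[(c n <= k)%N]ltnS -[(k <= c n)%N]ltnS -!(ltr_nat R) -!natr1.
by apply/andP; split; lra.
Qed.

(** The probability generating functional truncated to the first [n] points: with [f x] the
    probability that a point at [x] blocks, the probability that none of them does. *)
Definition avoid f n : R :=
  fine (\int[P]_w (\prod_(i < n) (1 - f (X i w)))%:E)%E.

Lemma measurable_avoid f n : measurable_fun setT f ->
  measurable_fun setT (fun w => \prod_(i < n) (1 - f (X i w))).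
Proof.
move=> mf; apply: measurable_prod => i _; apply: measurable_funB => //.
by apply: measurableT_comp.
Qed.

Lemma avoid_itv f n w : (forall x, 0 <= f x <= 1) ->
  0 <= \prod_(i < n) (1 - f (X i w)) <= 1.
Proof.
move=> f01; apply/andP; split.
  by apply: prodr_ge0 => i _; rewrite subr_ge0; have /andP[] := f01 (X i w).
apply: prodr_ile1 => i _.
by have /andP[f0 f1] := f01 (X i w); rewrite subr_ge0 f1 gerBl.
Qed.

Lemma integrable_avoid f n : measurable_fun setT f -> (forall x, 0 <= f x <= 1) ->
  P.-integrable setT (fun w => (\prod_(i < n) (1 - f (X i w)))%:E).
Proof.
move=> mf f01; apply: (@le_integrable _ _ _ _ _ _ _ (cst 1%E)) => //.
- by apply/measurable_EFinP; exact: measurable_avoid.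
- move=> w _ /=; have /andP[p0 p1] := avoid_itv n w f01.
  by rewrite ger0_norm// normr1 lee_fin.
- apply/integrableP; split => //.
  by under eq_integral do rewrite /= normr1; rewrite integral_cst//= mul1e probability_setT ltry.
Qed.

Lemma avoidE f n : measurable_fun setT f -> (forall x, 0 <= f x <= 1) ->
  (avoid f n)%:E = (\int[P]_w (\prod_(i < n) (1 - f (X i w)))%:E)%E.
Proof.
by move=> mf f01; rewrite /avoid fineK//; apply: integrable_fin_num => //; exact: integrable_avoid.
Qed.

End pgfl.

Section pgfl_simple.
Context (R : realType) (d d' : measure_display) (Omega : measurableType d)
  (P : probability Omega R) (T : measurableType d').
Variables (X : nat -> {RV P >-> T}) (nu : {measure set T -> \bar R}).
Hypothesis XP : is_poisson_process nu X.
Implicit Types (f g : T -> R) (B : set T).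

(** Regrouped by level sets, the product tends to that of [(1 - b j)] to the power of the count in
    [B j], off a null set. Domination by 1 gives convergence of the means, and the limit is a
    product of Poisson generating functions. *)
Lemma avoid_disjoint f n (B : 'I_n -> set T) (b : 'I_n -> R) :
  (forall j, measurable (B j)) -> (forall j, (nu (B j) < +oo)%E) ->
  trivIset setT B -> (forall j, 0 <= b j <= 1) ->
  (forall x, 1 - f x = \prod_(j < n) (1 - b j * \1_(B j) x)) ->
  measurable_fun setT f -> (forall x, 0 <= f x <= 1) ->
  avoid X f m @[m --> \oo] --> expR (- \sum_(j < n) b j * fine (nu (B j))).
Proof.
move=> mB Boo tB b01 fE mf f01.
pose a j k := (1 - b j) ^+ k.
have a01 j k : 0 <= a j k <= 1.
  have /andP[b0 b1] := b01 j.
  by rewrite exprn_ge0 ?subr_ge0//= exprn_ile1 ?subr_ge0// gerBl.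
have a0 j k : 0 <= a j k by have /andP[] := a01 j k.
have limE : (\int[P]_w (\prod_(j < n) fun_npoints X (a j) (B j) w)%:E)%E =
    (expR (- \sum_(j < n) b j * fine (nu (B j))))%:E.
  rewrite (joint_poisson_mean XP)//; congr EFin.
  rewrite -sumrN expR_sum; apply: eq_bigr => j _; apply: EFin_inj.
  rewrite poisson_meanE// poisson_rate_sum; last first.
    by rewrite subr_ge0; have /andP[] := b01 j.
  by congr (expR (- _))%:E; rewrite opprB addrC subrK.
suff : (\int[P]_w (\prod_(i < m) (1 - f (X i w)))%:E)%E @[m --> \oo] -->
    (\int[P]_w (\prod_(j < n) fun_npoints X (a j) (B j) w)%:E)%E.
  by rewrite limE => /fine_cvg.
have mF m : measurable_fun [set: Omega] (fun w => (\prod_(i < m) (1 - f (X i w)))%:E).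
  by apply/measurable_EFinP; exact: (measurable_avoid X m mf).
have mL : measurable_fun [set: Omega]
    (fun w => (\prod_(j < n) fun_npoints X (a j) (B j) w)%:E).
  by apply/measurable_EFinP; apply: measurable_prod => j _;
    exact: measurable_fun_npoints.
have cvgL : {ae P, forall w, setT w ->
    (\prod_(i < m) (1 - f (X i w)))%:E @[m --> \oo] -->
    (\prod_(j < n) fun_npoints X (a j) (B j) w)%:E}.
  (* Induction on the list of indices turns the finitely many almost sure events into one. *)
  have : {ae P, forall w, forall j, j \in index_enum 'I_n -> finitely_many X (B j) w}.
    elim: (index_enum 'I_n) => [|j s IH]; first exact: aeW.
    have := ae_finitely_many XP (mB j) (Boo j); apply: filterS2 IH => w sw jw i.
    by rewrite inE => /orP[/eqP ->|/sw].
  apply: filterS => w Bw _; apply/cvg_EFin; first exact: nearW.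
  rewrite (_ : _ \o _ = fun m => \prod_(j < n) \prod_(i < m) (1 - b j * \1_(B j) (X i w))).
    apply: cvg_big => [|j _]; first exact: mul_continuous.
    have [k _ Bkw] := Bw j (mem_index_enum j).
    by rewrite (fun_npoints_fin _ Bkw)//; exact: cvg_prod_count.
  by apply/funext => m /=; rewrite exchange_big; apply: eq_bigr => i _.
have i1 : P.-integrable setT (cst 1%E : Omega -> \bar R).
  apply/integrableP; split => //.
  by under eq_integral do rewrite /= normr1; rewrite integral_cst//= mul1e probability_setT ltry.
have dom : {ae P, forall w m, setT w ->
    (`|(\prod_(i < m) (1 - f (X i w)))%:E| <= (cst 1%E : Omega -> \bar R) w)%E}.
  apply: aeW => w m _ /=; have /andP[p0 p1] := avoid_itv X m w f01.
  by rewrite ger0_norm// lee_fin.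
by have [_ _] := dominated_convergence measurableT mF mL cvgL i1 dom.
Qed.

Import HBNNSimple.

Lemma avoid_nnsfun (f : {nnsfun T >-> R}) : (forall x, f x <= 1) ->
  (\int[nu]_x (f x)%:E < +oo)%E ->
  avoid X f m @[m --> \oo] --> expR (- fine (\int[nu]_x (f x)%:E)%E).
Proof.
move=> f1 foo.
(* The value 0 is dropped because its level set may have infinite intensity. Every other level set
   has finite intensity, by integrability of [f]. *)
pose r := [seq y <- finmap.enum_fset (fset_set (range f)) | y != 0].
pose b (j : 'I_(size r)) := r`_j.
pose B j := f @^-1` [set b j].
have br j : (0 < b j) /\ (exists x, f x = b j).
  have : b j \in r by exact: mem_nth.
  rewrite mem_filter => /andP[bj0]; rewrite in_fset_set// inE => -[x _ fx].
  by split; [rewrite lt_neqAle eq_sym bj0 -fx fun_ge0|exists x].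
have ur : uniq r by apply: filter_uniq; exact: finmap.fset_uniq.
have If : (\int[nu]_x (f x)%:E = \sum_(j < size r) (b j)%:E * nu (B j))%E.
  rewrite integralT_nnsfun sintegralE fsbig_finite//.
  rewrite (bigID (fun y => y == 0))/= big1 ?add0e; last first.
    by move=> y /eqP ->; rewrite mul0e.
  by rewrite -big_filter (big_nth 0) big_mkord.
have nuB j : (nu (B j) < +oo)%E.
  have [b0 _] := br j.
  have : ((b j)%:E * nu (B j) < +oo)%E.
    apply: le_lt_trans foo; rewrite If (bigD1 j)//= leeDl//.
    by apply: sume_ge0 => i _; rewrite mule_ge0// lee_fin ltW//; have [] := br i.
  case: (ltP (nu (B j)) +oo%E) => //; rewrite leye_eq => /eqP ->.
  by rewrite gt0_muley// lte_fin.
have fine_If : fine (\int[nu]_x (f x)%:E)%E = \sum_(j < size r) b j * fine (nu (B j)).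
  rewrite If; apply: EFin_inj; rewrite -sumEFin fineK.
    by apply: eq_bigr => j _; rewrite EFinM fineK// ge0_fin_numE.
  by rewrite -If ge0_fin_numE// integral_ge0// => x _; rewrite lee_fin.
rewrite fine_If; apply: avoid_disjoint => //.
- by move=> j; rewrite -[X in measurable X]setTI; exact: measurable_funP.
- apply/trivIsetP => i j _ _ ij; apply/seteqP; split => // x [/= fi fj].
  move: ij; rewrite -(inj_eq val_inj)/= -(nth_uniq 0 (ltn_ord i) (ltn_ord j) ur).
  by rewrite -/(b i) -/(b j) -fi -fj eqxx.
- by move=> j; have [bj [x fx]] := br j; rewrite ltW//= -fx.
- move=> x; have [fx0|fx0] := eqVneq (f x) 0.
    rewrite fx0 subr0 big1// => j _; rewrite indicE memNset ?mulr0 ?subr0//.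
    by rewrite /B/= fx0 => b0; have [] := br j; rewrite -b0 ltxx.
  have xr : f x \in r.
    by rewrite mem_filter fx0 in_fset_set// inE; exists x.
  have ix : (index (f x) r < size r)%N by rewrite index_mem.
  have bx : b (Ordinal ix) = f x by rewrite /b/= nth_index.
  rewrite (bigD1 (Ordinal ix))//= big1 ?mulr1; last first.
    move=> j jx; rewrite indicE memNset ?mulr0 ?subr0// /B/= => fx.
    move/eqP: jx; apply; apply/val_inj => /=.
    by rewrite fx index_uniq.
  by rewrite bx indicE mem_set ?mulr1//= /B/= bx.
- by move=> x; rewrite f1 fun_ge0.
Qed.

End pgfl_simple.

Section pgfl_general.
Context (R : realType) (d d' : measure_display) (Omega : measurableType d)
  (P : probability Omega R) (T : measurableType d').
Variables (X : nat -> {RV P >-> T}) (nu : {measure set T -> \bar R}).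
Hypothesis XP : is_poisson_process nu X.
Implicit Types (f g : T -> R).

(** A union bound: replacing the factors one at a time, each change costs at most [u i - v i], as
    all other factors lie in [0, 1]. *)
Lemma ler_prod_sub n (u v : 'I_n -> R) :
  (forall i, 0 <= v i) -> (forall i, v i <= u i) -> (forall i, u i <= 1) ->
  \prod_(i < n) (1 - v i) <= \prod_(i < n) (1 - u i) + \sum_(i < n) (u i - v i).
Proof.
elim: n u v => [|n IH] u v v0 vu u1; first by rewrite !big_ord0 addr0.
rewrite !big_ord_recr /=.
set pv := \prod_(i < n) (1 - v (widen_ord _ i)).
set pu := \prod_(i < n) (1 - u (widen_ord _ i)).
have := IH (fun i => u (widen_ord (leqnSn n) i)) (fun i => v (widen_ord (leqnSn n) i))
  (fun=> v0 _) (fun=> vu _) (fun=> u1 _).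
rewrite -/pv -/pu; set S := \sum_(i < n) _ => IHn.
have pv1 : pv <= 1.
  by apply: prodr_ile1 => i _; rewrite subr_ge0 gerBl v0 (le_trans (vu _) (u1 _)).
have pv0 : 0 <= pv.
  by apply: prodr_ge0 => i _; rewrite subr_ge0 (le_trans (vu _) (u1 _)).
have S0 : 0 <= S by apply: sumr_ge0 => i _; rewrite subr_ge0.
have := v0 ord_max; have := vu ord_max; have := u1 ord_max.
move: (u ord_max) (v ord_max) => a b a1 ba b0.
(* Here [pv * (1 - b) = pv * (1 - a) + pv * (a - b)]: the induction hypothesis scaled by [1 - a]
   bounds the first term, and [pv <= 1] the second. *)
have h1 : (pv - pu - S) * (1 - a) <= 0 by nra.
have h2 : pv * (a - b) <= a - b by nra.
have h3 : S * (1 - a) <= S by nra.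
by lra.
Qed.

Lemma le_avoid f g n : measurable_fun setT f -> measurable_fun setT g ->
  (forall x, 0 <= f x <= 1) -> (forall x, 0 <= g x <= 1) ->
  (forall x, g x <= f x) -> avoid X f n <= avoid X g n.
Proof.
move=> mf mg f01 g01 gf; rewrite -lee_fin !avoidE//.
apply: ge0_le_integral => //.
- by move=> w _; rewrite lee_fin; have /andP[] := avoid_itv X n w f01.
- by apply/measurable_EFinP; exact: (measurable_avoid X n mf).
- by apply/measurable_EFinP; exact: (measurable_avoid X n mg).
- move=> w _; rewrite lee_fin; apply: ler_prod => i _.
  by rewrite lerD2l lerN2 gf subr_ge0 andbT; have /andP[] := f01 (X i w).
Qed.

(** The error term does not depend on [n]; this uniformity is what permits exchanging the limits in
    [pgfl]. *)
Lemma avoid_le_mean f g n : measurable_fun setT f -> measurable_fun setT g ->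
  (forall x, 0 <= f x <= 1) -> (forall x, 0 <= g x <= 1) ->
  (forall x, g x <= f x) ->
  ((avoid X g n)%:E <= (avoid X f n)%:E + \int[nu]_x (f x - g x)%:E)%E.
Proof.
move=> mf mg f01 g01 gf; rewrite !avoidE//.
have h0 x : 0 <= f x - g x by rewrite subr_ge0.
have mh : measurable_fun setT (fun x => f x - g x) by exact: measurable_funB.
have mhX i : measurable_fun setT (fun w => (f (X i w) - g (X i w))%:E).
  apply/measurable_EFinP.
  by apply: (measurableT_comp mh).
have intD : (\int[P]_w ((\prod_(i < n) (1 - f (X i w)))%:E +
      \sum_(i < n) (f (X i w) - g (X i w))%:E) =
    \int[P]_w (\prod_(i < n) (1 - f (X i w)))%:E +
      \sum_(i < n) \int[P]_w (f (X i w) - g (X i w))%:E)%E.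
  rewrite ge0_integralD//; last 4 first.
  - by move=> w _; rewrite lee_fin; have /andP[] := avoid_itv X n w f01.
  - by apply/measurable_EFinP; exact: (measurable_avoid X n mf).
  - by move=> w _; apply: sume_ge0 => i _; rewrite lee_fin.
  - by apply: emeasurable_sum => i; exact: mhX.
  by rewrite ge0_integral_sum// => i w _; rewrite lee_fin.
apply: (@le_trans _ _ (\int[P]_w ((\prod_(i < n) (1 - f (X i w)))%:E +
    \sum_(i < n) (f (X i w) - g (X i w))%:E))%E).
  apply: ge0_le_integral => //.
  - by move=> w _; rewrite lee_fin; have /andP[] := avoid_itv X n w g01.
  - by apply/measurable_EFinP; exact: (measurable_avoid X n mg).
  - apply: emeasurable_funD; last by apply: emeasurable_sum => i; exact: mhX.
    by apply/measurable_EFinP; exact: (measurable_avoid X n mf).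
  - move=> w _; rewrite sumEFin -EFinD lee_fin.
    apply: ler_prod_sub => i //; first by have /andP[] := g01 (X i w).
    by have /andP[] := f01 (X i w).
rewrite intD; apply: leeD => //; apply: le_trans (campbell_le XP mh h0).
rewrite -(big_mkord xpredT (fun i => \int[P]_w (f (X i w) - g (X i w))%:E)%E).
apply: nneseries_lim_ge => i _ _.
by apply: integral_ge0 => w _; rewrite lee_fin.
Qed.

Import HBNNSimple.

(** With simple [g m] increasing to [f], [avoid X f n] lies between [avoid X (g m) n] minus the
    integral of [f - g m] and [avoid X (g m) n], for all [n] at once. *)
Lemma pgfl f : measurable_fun setT f -> (forall x, 0 <= f x <= 1) ->
  (\int[nu]_x (f x)%:E < +oo)%E ->
  avoid X f n @[n --> \oo] --> expR (- fine (\int[nu]_x (f x)%:E)%E).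
Proof.
move=> mf f01 foo.
have f0 x : 0 <= f x by have /andP[] := f01 x.
have f1 x : f x <= 1 by have /andP[] := f01 x.
have mEf : measurable_fun [set: T] (EFin \o f) by exact/measurable_EFinP.
have [g [ndg cvg_g]] := approximation measurableT mEf (fun x _ => f0 x).
have cvg_gx x : g m x @[m --> \oo] --> f x.
  by have /fine_cvg := cvg_g x I.
have gf m x : g m x <= f x.
  have /nondecreasing_cvgn_le : nondecreasing_seq (g ^~ x).
    by move=> i j ij; have /lefP := ndg i j ij; exact.
  move=> /(_ (cvgP _ (cvg_gx x)) m); by rewrite (cvg_lim _ (cvg_gx x)).
have g01 m x : 0 <= g m x <= 1 by rewrite fun_ge0 (le_trans (gf m x)).
have goo m : (\int[nu]_x (g m x)%:E < +oo)%E.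
  apply: le_lt_trans foo; apply: ge0_le_integral => //.
  - by move=> x _; rewrite lee_fin.
  - exact/measurable_EFinP.
  - by move=> x _; rewrite lee_fin.
pose If := fine (\int[nu]_x (f x)%:E)%E.
pose Ig m := fine (\int[nu]_x (g m x)%:E)%E.
have IgE m : (\int[nu]_x (g m x)%:E = (Ig m)%:E)%E.
  by rewrite fineK// ge0_fin_numE// integral_ge0// => x _; rewrite lee_fin.
have IfE : (\int[nu]_x (f x)%:E = If%:E)%E.
  by rewrite fineK// ge0_fin_numE// integral_ge0// => x _; rewrite lee_fin.
have cvg_Ig : Ig m @[m --> \oo] --> If.
  apply: (@fine_cvg _ _ _ _ (fun m => \int[nu]_x (g m x)%:E)%E); rewrite -IfE.
  rewrite [X in _ --> X](_ : _ = \int[nu]_x limn (fun m => (g m x)%:E))%E; last first.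
    by apply: eq_integral => x _; apply/esym/cvg_lim => //; exact: (cvg_g x I).
  apply: (@cvg_monotone_convergence _ _ _ nu setT measurableT (fun m x => (g m x)%:E)).
  - by move=> m; exact/measurable_EFinP.
  - by move=> m x _; rewrite lee_fin.
  - by move=> x _ i j ij; rewrite lee_fin; have /lefP := ndg i j ij; exact.
have diff m : (\int[nu]_x (f x - g m x)%:E = (If - Ig m)%:E)%E.
  rewrite EFinB -IfE -IgE.
  have -> : (\int[nu]_x (f x)%:E =
      \int[nu]_x (f x - g m x)%:E + \int[nu]_x (g m x)%:E)%E.
    rewrite -ge0_integralD//.
    - by apply: eq_integral => x _; rewrite -EFinD subrK.
    - by move=> x _; rewrite lee_fin subr_ge0.
    - by apply/measurable_EFinP; exact: measurable_funB.
    - by move=> x _; rewrite lee_fin.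
    - exact/measurable_EFinP.
  by rewrite addeK// IgE.
have cvg_exp : expR (- Ig m) @[m --> \oo] --> expR (- If).
  by apply: continuous_cvg; [exact: continuous_expR|exact: cvgN].
apply/cvgrPdist_le => e e0.
(* Three errors: the integral of [f - g m], the difference of the two exponentials, and the
   convergence in [n] for the fixed simple function [g m]. *)
have e3 : 0 < e / 3 by rewrite divr_gt0.
near \oo => m.
have m1 : `|If - Ig m| <= e / 3.
  by near: m; move/cvgrPdist_le : cvg_Ig; exact.
have m2 : `|expR (- If) - expR (- Ig m)| <= e / 3.
  by near: m; move/cvgrPdist_le : cvg_exp; exact.
have := avoid_nnsfun XP (fun x => le_trans (gf m x) (f1 x)) (goo m).
move/cvgrPdist_le => /(_ _ e3); rewrite -/(Ig m); apply: filterS => n n1.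
have d1 := le_avoid n mf (@measurable_funPT _ _ _ _ (g m)) f01 (g01 m) (gf m).
have := avoid_le_mean n mf (@measurable_funPT _ _ _ _ (g m)) f01 (g01 m) (gf m).
rewrite diff -EFinD lee_fin => d2.
rewrite -/If; move: m1 m2 n1; rewrite !ler_norml.
by move=> /andP[? ?] /andP[? ?] /andP[? ?]; apply/andP; split; lra.
Unshelve. all: by end_near.
Qed.

End pgfl_general.

(** * Void probabilities of the marked process *)

Section marked_void.
Context (R : realType) (d d1 d2 d3 : measure_display) (Omega : measurableType d)
  (T : measurableType d1) (M1 : measurableType d2) (M2 : measurableType d3)
  (P : probability Omega R).
Variables (X : nat -> {RV P >-> T}) (Y : nat -> {RV P >-> M1})
  (Z : nat -> {RV P >-> M2}).
Variables (nu : {measure set T -> \bar R}) (Q : probability (M1 * M2)%type R).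
Hypothesis XP : is_poisson_process nu X.
Hypothesis indep : forall (n : nat) (A : 'I_n -> set T) (B : 'I_n -> set M1)
    (C : 'I_n -> set M2),
  (forall i, measurable (A i)) -> (forall i, measurable (B i)) ->
  (forall i, measurable (C i)) ->
  P [set w | forall i : 'I_n, [/\ A i (X i w), B i (Y i w) & C i (Z i w)]] =
  (P [set w | forall i : 'I_n, A i (X i w)] * \prod_(i < n) Q (B i `*` C i))%E.

(** The event is the decreasing intersection of the events [E n] that the first [n] marked points
    miss [G]. By [marking], [E n] has the probability [avoid] of the mark probability of [G], whose
    limit is given by [pgfl]. *)
Lemma marked_void_prob (G : set (T * (M1 * M2))) : measurable G ->
  (\int[nu]_x Q (xsection G x) < +oo)%E ->
  measurable [set w | forall i, ~ G (X i w, (Y i w, Z i w))] /\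
  P [set w | forall i, ~ G (X i w, (Y i w, Z i w))] =
  (expR (- fine (\int[nu]_x Q (xsection G x))%E))%:E.
Proof.
move=> mG Goo.
pose E n := [set w | forall i : 'I_n, (~` G) (X i w, (Y i w, Z i w))].
have mE n : measurable (E n).
  by apply: (@measurable_marked_event _ _ _ _ _ _ _ _ X Y Z n (fun=> ~` G)) => _;
    exact: measurableC.
have -> : [set w | forall i, ~ G (X i w, (Y i w, Z i w))] = \bigcap_n E n.
  apply/seteqP; split => w /= H; first by move=> n _ i; exact: H.
  by move=> i; exact: (H i.+1 I ord_max).
split; first exact: bigcapT_measurable.
have fE : (\int[nu]_x Q (xsection G x) = \int[nu]_x (mark_prob Q G x)%:E)%E.
  by apply: eq_integral => x _; rewrite mark_probE.
have PE n : P (E n) = (avoid X (mark_prob Q G) n)%:E.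
  rewrite avoidE//; last 2 first.
  - exact: measurable_mark_prob.
  - by move=> x; exact: mark_prob_itv.
  apply: etrans (marking indep (G := fun=> ~` G) (fun=> measurableC mG)) _.
  apply: eq_integral => w _; congr EFin; apply: eq_bigr => i _.
  apply: EFin_inj; rewrite EFinB !mark_probE//; last exact: measurableC.
  have mGx : measurable (xsection G (X i w)) by exact: measurable_xsection.
  by rewrite -(probability_setC Q mGx); congr (Q _); apply/seteqP; split=> y;
    rewrite /xsection/= in_setC => /negP.
have : P (E n) @[n --> \oo] --> P (\bigcap_n E n).
  apply: nonincreasing_cvg_mu => //.
  - by apply: (@le_lt_trans _ _ 1%E); [exact: probability_le1|exact: ltry].
  - exact: bigcapT_measurable.
  - move=> m n mn; apply/subsetPset => w Ew i.
    by have := Ew (widen_ord mn i).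
move/cvg_lim => <- //; apply/cvg_lim => //.
rewrite (funext PE); apply: cvg_EFin; first exact: nearW.
have := pgfl XP (measurable_mark_prob Q mG) (fun x => mark_prob_itv Q x mG).
by rewrite -fE; exact.
Qed.

End marked_void.

(** * Geometry of the blockages *)

Lemma product_measure12 (R : realType) (d1 d2 : measure_display)
  (T1 : measurableType d1) (T2 : measurableType d2)
  (m1 : {sigma_finite_measure set T1 -> \bar R})
  (m2 : {sigma_finite_measure set T2 -> \bar R}) (A : set (T1 * T2)) :
  measurable A -> ((m1 \x m2) A = (m1 \x^ m2) A)%E.
Proof.
move=> mA; apply: (product_measure_unique (m' := (m1 \x^ m2)%E)) => //.
by move=> B C mB mC; exact: product_measure2E.
Qed.

Section area_shear.
Variable R : realType.
Local Notation leb := (@lebesgue_measure R).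

Lemma lebesgue_measureD (a : R) (A : set R) : measurable A ->
  leb ((fun x => x + a) @^-1` A) = leb A.
Proof.
move=> mA.
have ma : measurable_fun setT ((fun x => x + a) : measurableTypeR R -> measurableTypeR R).
  exact: measurable_funD.
apply/esym/(lebesgue_measure_unique (mu := image_measure leb ma)) => // _ [[u v] _ <-] /=.
rewrite /pushforward (_ : _ @^-1` _ = `](u - a), (v - a)]%classic).
  rewrite !lebesgue_measure_itv/= !lte_fin ltrD2r -!EFinB.
  by case: ifP => // _; congr EFin; ring.
by apply/seteqP; split => x /=; rewrite !in_itv/= ltrBlDr lerBrDr.
Qed.

(** For [k] the cotangent of [phi], vertical lines are sent to lines of direction [phi], so the
    preimage of a blockage is a vertical segment. *)
Definition shear (k : R) (z : R * R) : R * R := (z.1 + z.2 * k, z.2).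

Lemma measurable_shear k : measurable_fun setT (shear k).
Proof.
apply: measurable_fun_pair; last exact: measurable_snd.
apply: measurable_funD; first exact: measurable_fst.
by apply: measurable_funM => //; exact: measurable_snd.
Qed.

Lemma area_ysection (A : set (R * R)) : measurable A ->
  area A = (\int[leb]_y leb (ysection A y))%E.
Proof.
by move=> mA; exact: (product_measure12 leb leb mA).
Qed.

Lemma area_shear k (A : set (R * R)) : measurable A ->
  area A = area (shear k @^-1` A).
Proof.
move=> mA.
have mS : measurable (shear k @^-1` A).
  by rewrite -[X in measurable X]setTI; exact: measurable_shear.
rewrite !area_ysection//; apply: eq_integral => y _.
rewrite -(lebesgue_measureD (y * k)); last exact: measurable_ysection.
congr (leb _); apply/seteqP; split=> x; rewrite /ysection/= !inE;
  by rewrite /preimage /shear.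
Qed.

End area_shear.

Section hitting.
Variable R : realType.
Implicit Types (r th l phi : R) (c : R * R).

Definition hit r th : set ((R * R) * (R * R)) :=
  [set z | link r th `&` blockage z.1 z.2.1 z.2.2 !=set0].

Lemma hitP r th c l phi : hit r th (c, (l, phi)) <->
  exists t s, [/\ 0 <= t <= r, - (l / 2) <= s <= l / 2,
    t * cos th = c.1 + s * cos phi & t * sin th = c.2 + s * sin phi].
Proof.
split.
- move=> [z [[t t0r ->] [s sl [e1 e2]]]]; exists t, s; split => //.
- move=> [t [s [tr sl e1 e2]]].
  exists (t * cos th, t * sin th); split; first by exists t.
  by exists s => //=; rewrite -e1 -e2.
Qed.

(** Cramer's rule: the two lines meet at the parameters [t = q / D] and [s = p / D]. Multiplying the
    bounds by [D ^+ 2] avoids both the division and the sign of [D]. *)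
Lemma hit_transversal r th c l phi : sin (phi - th) != 0 ->
  hit r th (c, (l, phi)) <->
  let D := sin (phi - th) in
  let q := c.1 * sin phi - c.2 * cos phi in
  let p := c.1 * sin th - c.2 * cos th in
  (0 <= D * q <= r * D ^+ 2) /\ (- (l / 2) * D ^+ 2 <= D * p <= l / 2 * D ^+ 2).
Proof.
move=> D0; rewrite hitP; cbv zeta; set D := sin (phi - th) in D0 *.
set q := c.1 * sin phi - c.2 * cos phi.
set p := c.1 * sin th - c.2 * cos th.
have DE : D = sin phi * cos th - cos phi * sin th by rewrite /D sinB.
have D2 : 0 < D ^+ 2 by rewrite exprn_even_gt0.
have th1 := cos2Dsin2 th; have phi1 := cos2Dsin2 phi.
split.
- move=> [t [s [/andP[t0 tr] /andP[s1 s2] e1 e2]]].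
  have qE : q = t * D.
    rewrite /q DE mulrBr.
    transitivity ((t * cos th - s * cos phi) * sin phi - (t * sin th - s * sin phi) * cos phi).
      by rewrite e1 e2; ring.
    ring.
  have pE : p = s * D.
    rewrite /p DE.
    transitivity ((t * cos th - s * cos phi) * sin th - (t * sin th - s * sin phi) * cos th).
      by rewrite e1 e2; ring.
    ring.
  have -> : D * q = t * D ^+ 2 by rewrite qE; ring.
  have -> : D * p = s * D ^+ 2 by rewrite pE; ring.
  by rewrite !ler_pM2r// mulr_ge0//; [rewrite tr s1 s2|exact: ltW].
- move=> [/andP[q0 qr] /andP[p1 p2]].
  have c1 : c.1 * D = q * cos th - p * cos phi.
    by rewrite DE /q /p; ring.
  have c2 : c.2 * D = q * sin th - p * sin phi.
    by rewrite DE /q /p; ring.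
  exists (q / D), (p / D).
  have qD : q / D = D * q / D ^+ 2 by field.
  have pD : p / D = D * p / D ^+ 2 by field.
  split.
  + by rewrite qD ler_pdivrMr// qr divr_ge0// ltW.
  + by rewrite pD ler_pdivrMr// ler_pdivlMr// p1 p2.
  + by rewrite (canRL (mulfK D0) c1); field.
  + by rewrite (canRL (mulfK D0) c2); field.
Qed.

(** The center must lie on the line of the link. There [e] is its coordinate, and the interval of
    half-length [l / 2] around [e] must meet [[0, r]]. *)
Lemma hit_parallel r th c l phi : sin (phi - th) = 0 -> 0 <= r -> 0 <= l ->
  hit r th (c, (l, phi)) <->
  let e := c.1 * cos th + c.2 * sin th in
  c.1 * sin th - c.2 * cos th = 0 /\ - (l / 2) <= e <= r + l / 2.
Proof.
move=> D0 r0 l0; cbv zeta; set e := c.1 * cos th + _; set k := cos (phi - th).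
have k2 : k = 1 \/ k = -1.
  have : k ^+ 2 = 1 by have := cos2Dsin2 (phi - th); rewrite D0 expr0n addr0.
  by move/eqP; rewrite sqrf_eq1 => /orP[]/eqP; [left|right].
have cphi : cos phi = k * cos th.
  by rewrite -{1}(subrK th phi) cosD D0 mul0r subr0.
have sphi : sin phi = k * sin th.
  by rewrite -{1}(subrK th phi) sinD D0 mul0r add0r.
have th1 := cos2Dsin2 th.
rewrite hitP cphi sphi; split.
- move=> [t [s [/andP[t0 tr] /andP[s1 s2] e1 e2]]].
  have eE : e = t - s * k.
    rewrite /e.
    transitivity ((t - s * k) * (cos th ^+ 2 + sin th ^+ 2)); last by rewrite th1 mulr1.
    transitivity ((t * cos th - s * (k * cos th)) * cos th +
      (t * sin th - s * (k * sin th)) * sin th).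
      by rewrite e1 e2; ring.
    ring.
  split.
    transitivity ((t * cos th - s * (k * cos th)) * sin th -
      (t * sin th - s * (k * sin th)) * cos th); last by ring.
    by rewrite e1 e2; ring.
  by rewrite eE; case: k2 => ->; apply/andP; split; lra.
- move=> [p0 /andP[e1 e2]].
  have c1 : c.1 = e * cos th.
    transitivity (c.1 * (cos th ^+ 2 + sin th ^+ 2)); first by rewrite th1 mulr1.
    by rewrite /e; transitivity (e * cos th + (c.1 * sin th - c.2 * cos th) * sin th);
      [rewrite /e; ring|rewrite p0 mul0r addr0].
  have c2 : c.2 = e * sin th.
    transitivity (c.2 * (cos th ^+ 2 + sin th ^+ 2)); first by rewrite th1 mulr1.
    by rewrite /e; transitivity (e * sin th - (c.1 * sin th - c.2 * cos th) * cos th);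
      [rewrite /e; ring|rewrite p0 mul0r subr0].
  have kk : k * k = 1 by case: k2 => ->; ring.
  (* The witness is the point of [[0, r]] nearest to [e]. *)
  have [t [/andP[t0 tr] /andP[te1 te2]]] :
      exists t, 0 <= t <= r /\ - (l / 2) <= t - e <= l / 2.
    have [e0|e0] := leP e 0; first by exists 0; split; apply/andP; split; lra.
    have [er|er] := leP e r; first by exists e; split; apply/andP; split; lra.
    by exists r; split; apply/andP; split; lra.
  exists t, ((t - e) * k); split.
  + by rewrite t0 tr.
  + by case: k2 => ->; apply/andP; split; lra.
  + by rewrite c1 -mulrA (mulrA k) kk mul1r -mulrDl addrC subrK.
  + by rewrite c2 -mulrA (mulrA k) kk mul1r -mulrDl addrC subrK.
Qed.

End hitting.

Lemma measurable_set_le (R : realType) d (T : measurableType d) (f g : T -> R) :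
  measurable_fun setT f -> measurable_fun setT g -> measurable [set x | f x <= g x].
Proof.
move=> mf mg; rewrite -[X in measurable X]setTI.
exact: (measurable_fun_ler mf mg measurableT (Y := [set true])).
Qed.

Section hit_measurable.
Variable R : realType.
Implicit Types (r th l phi : R) (c : R * R).

Lemma measurable_sin : measurable_fun setT (@sin R).
Proof. by apply: continuous_measurable_fun; exact: continuous_sin. Qed.

Lemma measurable_cos : measurable_fun setT (@cos R).
Proof. by apply: continuous_measurable_fun; exact: continuous_cos. Qed.

(** By definition [hit] is a projection, of which measurability is not immediate. The two criteria
    above eliminate the parameters and leave inequalities between measurable functions. *)
Lemma measurable_hit r th : 0 <= r -> measurable (hit r th).
Proof.
move=> r0.
pose T := ((R * R) * (R * R))%type.
have m11 : measurable_fun setT (fun z : T => z.1.1).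
  exact: (measurableT_comp measurable_fst measurable_fst).
have m12 : measurable_fun setT (fun z : T => z.1.2).
  exact: (measurableT_comp measurable_snd measurable_fst).
have m21 : measurable_fun setT (fun z : T => z.2.1).
  exact: (measurableT_comp measurable_fst measurable_snd).
have m22 : measurable_fun setT (fun z : T => z.2.2).
  exact: (measurableT_comp measurable_snd measurable_snd).
pose D (z : T) := sin (z.2.2 - th).
pose q (z : T) := z.1.1 * sin z.2.2 - z.1.2 * cos z.2.2.
pose p (z : T) := z.1.1 * sin th - z.1.2 * cos th.
pose e (z : T) := z.1.1 * cos th + z.1.2 * sin th.
have mD : measurable_fun setT D.
  apply: (measurableT_comp measurable_sin); exact: measurable_funB.
have mq : measurable_fun setT q.
  apply: measurable_funB; apply: measurable_funM => //.
    exact: (measurableT_comp measurable_sin).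
  exact: (measurableT_comp measurable_cos).
have mp : measurable_fun setT p by apply: measurable_funB; exact: measurable_funM.
have me : measurable_fun setT e by apply: measurable_funD; exact: measurable_funM.
have mD2 : measurable_fun setT (fun z => D z ^+ 2) by exact: measurable_funX.
have ml : measurable_fun setT (fun z : T => z.2.1 / 2) by exact: measurable_funM.
(* The parallel case, [D z = 0] written as two inequalities. It carries the extra condition
   [0 <= z.2.1] below, because a blockage of negative length is empty. *)
pose Z := [set z | D z <= 0] `&` [set z | 0 <= D z].
have -> : hit r th =
  (~` Z `&` ([set z | 0 <= D z * q z] `&` [set z | D z * q z <= r * D z ^+ 2] `&`
     ([set z | - (z.2.1 / 2) * D z ^+ 2 <= D z * p z] `&`
      [set z | D z * p z <= z.2.1 / 2 * D z ^+ 2]))) `|`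
  (Z `&` ([set z | 0 <= z.2.1] `&` ([set z | p z <= 0] `&` [set z | 0 <= p z] `&`
     ([set z | - (z.2.1 / 2) <= e z] `&` [set z | e z <= r + z.2.1 / 2])))).
  apply/seteqP; split=> -[c [l phi]].
    have [D0|D0] := eqVneq (sin (phi - th)) 0.
      move=> H; right; split; first by rewrite /Z /D /= D0 lexx.
      have l0 : 0 <= l by move/hitP : H => [t [s [_ /andP[? ?] _ _]]]; lra.
      by move/(hit_parallel _ D0 r0 l0) : H => [+ /andP[]]; rewrite /p/= => -> ? ?; rewrite lexx.
    move/(hit_transversal _ _ _ D0) => [/andP[? ?] /andP[? ?]]; left; split => //=.
    by move=> [/= Dl Dg]; move: D0; rewrite eq_le /D/= in Dl Dg *; rewrite Dl Dg.
  case=> [[Z0 [[/= h1 h2] [h3 h4]]]|[[/= Z1 Z2] [/= l0 [[p1 p2] [e1 e2]]]]].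
    apply/hit_transversal.
      by apply/eqP => D0; apply: Z0; rewrite /Z /D/= D0 lexx.
    by split; apply/andP.
  have D0 : sin (phi - th) = 0 by apply/eqP; rewrite eq_le; apply/andP.
  apply/(hit_parallel _ D0 r0 l0); split; last exact/andP.
  by apply/eqP; rewrite eq_le; apply/andP.
have mZ : measurable Z by apply: measurableI; exact: measurable_set_le.
have mDq : measurable_fun setT (fun z => D z * q z) by exact: measurable_funM.
have mDp : measurable_fun setT (fun z => D z * p z) by exact: measurable_funM.
apply: measurableU; apply: measurableI => //.
- exact: measurableC.
- apply: measurableI; apply: measurableI; apply: measurable_set_le => //.
  + exact: measurable_funM.
  + by apply: measurable_funM => //; exact: measurable_funN.
  + exact: measurable_funM.
- apply: measurableI; first exact: measurable_set_le.
  apply: measurableI; apply: measurableI; apply: measurable_set_le => //.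
  + exact: measurable_funN.
  + exact: measurable_funD.
Qed.

End hit_measurable.

Section hit_area.
Variable R : realType.
Implicit Types (r th l phi : R) (c : R * R).
Local Notation leb := (@lebesgue_measure R).

(* In the coordinates (x - y cot phi, y) the centers hitting the link form a
   union of vertical segments of length [l * sin phi] above this interval. *)
Definition shadow r th phi : set R :=
  [set x | 0 <= sin (phi - th) * x <= r * sin (phi - th) ^+ 2 / sin phi].

Definition cot phi : R := cos phi / sin phi.

(** After the shear, [q] of [hit_transversal] becomes [x * sin phi], a function of [x] alone, and
    [p] is affine in [y]. So the first condition selects the abscissa and the second a vertical
    interval around [m]. *)
Lemma sheared_hit r th l phi x y : 0 < sin phi -> sin (phi - th) != 0 ->
  hit r th (shear (cot phi) (x, y), (l, phi)) <->
  shadow r th phi x /\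
  (let m := x * sin phi * sin th / sin (phi - th) in
   m - l * sin phi / 2 <= y <= m + l * sin phi / 2).
Proof.
move=> s0 D0; rewrite hit_transversal//; cbv zeta; rewrite /shear /shadow /cot/=.
have sN0 : sin phi != 0 by rewrite gt_eqF.
have -> : (x + y * (cos phi / sin phi)) * sin phi - y * cos phi = x * sin phi.
  by field.
have -> : (x + y * (cos phi / sin phi)) * sin th - y * cos th =
    x * sin th - y * sin (phi - th) / sin phi.
  by rewrite sinB; field.
set D := sin (phi - th) in D0 *; set s := sin phi in s0 sN0 *.
have D2 : 0 < D ^+ 2 by rewrite exprn_even_gt0.
have -> : (0 <= D * (x * s) <= r * D ^+ 2) = (0 <= D * x <= r * D ^+ 2 / s).
  by rewrite mulrA pmulr_lge0// ler_pdivlMr.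
have -> : (- (l / 2) * D ^+ 2 <= D * (x * sin th - y * D / s) <= l / 2 * D ^+ 2) =
    (x * s * sin th / D - l * s / 2 <= y <= x * s * sin th / D + l * s / 2).
  have -> : D * (x * sin th - y * D / s) = (x * s * sin th / D - y) * (D ^+ 2 / s).
    by field; rewrite sN0 D0.
  have Ds : 0 < D ^+ 2 / s by rewrite divr_gt0.
  have -> : l / 2 * D ^+ 2 = (l * s / 2) * (D ^+ 2 / s) by field.
  have -> : - (l / 2) * D ^+ 2 = - (l * s / 2) * (D ^+ 2 / s) by field.
  rewrite !ler_pM2r//; apply/idP/idP => /andP[? ?]; apply/andP; split; lra.
by split.
Qed.

Lemma shadow_itv r th phi : 0 <= r -> 0 < sin phi -> sin (phi - th) != 0 ->
  measurable (shadow r th phi) /\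
  leb (shadow r th phi) = (r * `|sin (phi - th)| / sin phi)%:E.
Proof.
move=> r0 s0; rewrite /shadow; set D := sin (phi - th); set s := sin phi => D0.
have rs : 0 <= r / s by rewrite divr_ge0// ltW.
have [Dp|Dn|/eqP] := ltgtP 0 D; last by rewrite eq_sym (negbTE D0).
  have -> : [set x | 0 <= D * x <= r * D ^+ 2 / s] = `[0, r * D / s]%classic.
    apply/seteqP; split=> x /=; rewrite in_itv/= (_ : r * D ^+ 2 / s = D * (r * D / s));
      by [rewrite pmulr_rge0// ler_pM2l|ring].
  split => //; rewrite lebesgue_measure_itv/= lte_fin gtr0_norm// oppr0 adde0.
  have [//|] := ltP 0 (r * D / s); rewrite le_eqVlt => /predU1P[->//|].
  by rewrite ltNge mulrAC mulr_ge0// ltW.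
have -> : [set x | 0 <= D * x <= r * D ^+ 2 / s] = `[r * D / s, 0]%classic.
  apply/seteqP; split=> x /=; rewrite in_itv/= (_ : r * D ^+ 2 / s = D * (r * D / s));
    by [rewrite nmulr_rge0// ler_nM2l// andbC|ring].
split => //; rewrite lebesgue_measure_itv/= lte_fin ltr0_norm// add0e.
have -> : r * - D / s = - (r * D / s) by ring.
have [//|] := ltP (r * D / s) 0; rewrite le_eqVlt => /predU1P[<-|]; rewrite ?oppr0//.
by rewrite ltNge mulrAC mulr_ge0_le0// ltW.
Qed.

Lemma area_xsection (A : set (R * R)) : area A = (\int[leb]_x leb (xsection A x))%E.
Proof. by []. Qed.

Lemma measurable_hit_section r th m : 0 <= r -> measurable (ysection (hit r th) m).
Proof. by move=> r0; apply: measurable_ysection; exact: measurable_hit. Qed.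

(** Such a set lies on one line through the origin, the image of the vertical axis under the
    shear. *)
Lemma area_sheared_line0 k (A : set (R * R)) : measurable A ->
  (forall x y, A (shear k (x, y)) -> x = 0) -> area A = 0%E.
Proof.
move=> mA A0; rewrite (area_shear k)// area_xsection.
have mSA : measurable (shear k @^-1` A).
  by rewrite -[X in measurable X]setTI; apply: measurable_shear.
rewrite (ge0_negligible_integral (N := [set 0] : set (measurableTypeR R)))//; last 2 first.
- exact: measurable_fun_xsection.
- exact: lebesgue_measure_set1.
rewrite integral0_eq// => x [_ /= x0].
rewrite (_ : xsection _ x = set0) ?measure0//.
by apply/seteqP; split=> // y; rewrite /xsection/= inE => /A0.
Qed.

Lemma area_hit_parallel r th l phi : 0 <= r -> 0 <= l -> 0 < sin phi ->
  sin (phi - th) = 0 -> area (ysection (hit r th) (l, phi)) = 0%E.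
Proof.
move=> r0 l0 s0 D0; have sN0 : sin phi != 0 by rewrite gt_eqF.
apply: (area_sheared_line0 (k := cot phi)); first exact: measurable_hit_section.
have sth0 : sin th != 0.
  apply/eqP => sth; move: s0; rewrite -(subrK th phi) sinD D0 sth.
  by rewrite mul0r mulr0 addr0 ltxx.
move=> x y; rewrite /ysection/= inE => /(hit_parallel _ D0 r0 l0)[+ _] /=.
have -> : (x + y * cot phi) * sin th - y * cos th =
    x * sin th - y * sin (phi - th) / sin phi.
  by rewrite /cot sinB; field.
by rewrite D0 mulr0 mul0r subr0 => /eqP; rewrite mulf_eq0 (negbTE sth0) orbF => /eqP.
Qed.

(** The shadow has length [r * |sin (phi - th)| / sin phi] and each vertical section above it has
    length [l * sin phi]; the factor [sin phi] cancels. *)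
Lemma area_hit r th l phi : 0 <= r -> 0 <= l -> 0 < sin phi ->
  area (ysection (hit r th) (l, phi)) = (l * (r * `|sin (phi - th)|))%:E.
Proof.
move=> r0 l0 s0; have [D0|D0] := eqVneq (sin (phi - th)) 0.
  by rewrite area_hit_parallel// D0 normr0 !mulr0.
rewrite (area_shear (cot phi)); last exact: measurable_hit_section.
rewrite area_xsection.
have [mS lS] := shadow_itv r0 s0 D0.
have ls0 : 0 <= l * sin phi by rewrite mulr_ge0// ltW.
transitivity (\int[leb]_x ((l * sin phi)%:E * (\1_(shadow r th phi) x)%:E))%E; last first.
  rewrite ge0_integralZl ?lee_fin//; last by apply/measurable_EFinP; exact: measurable_indic.
  rewrite integral_indic// setIT [X in (_ * X)%E]lS -EFinM; congr EFin.
  by field; rewrite gt_eqF.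
apply: eq_integral => x _; rewrite indicE.
have [xS|xS] := boolP (x \in shadow r th phi).
  rewrite mule1.
  set m := x * sin phi * sin th / sin (phi - th).
  rewrite (_ : xsection _ x = `[m - l * sin phi / 2, m + l * sin phi / 2]%classic).
    rewrite lebesgue_measure_itv/= lte_fin -EFinB.
    have -> : m + l * sin phi / 2 - (m - l * sin phi / 2) = l * sin phi by field.
    case: ltP => // h; congr EFin; lra.
  apply/seteqP; split=> y; rewrite /xsection/= inE /preimage /ysection/= inE in_itv/=.
    by move/(sheared_hit _ _ _ _ s0 D0) => [].
  by move=> my; apply/(sheared_hit _ _ _ _ s0 D0); split; [exact: set_mem|].
rewrite mule0 (_ : xsection _ x = set0) ?measure0//.
apply/seteqP; split=> // y; rewrite /xsection/= inE /preimage /ysection/= inE.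
by move/(sheared_hit _ _ _ _ s0 D0) => [xS' _]; move: xS; rewrite notin_setE; exact.
Qed.

(** The shadow of the first link lies in [x >= 0], that of the second in [x >= 0] or [x <= 0]
    according to the sign of [D]. When [D < 0] they share at most the abscissa 0, and when [D = 0]
    the second set is itself null. *)
Lemma area_overlap r1 r2 th l phi : 0 <= r1 -> 0 <= r2 -> 0 <= l -> 0 < sin phi ->
  let ov := area (ysection (hit r1 0 `&` hit r2 th) (l, phi)) in
  let D := sin (phi - th) in
  (ov <= (l * (r1 * (if 0 < D then sin phi else 0)))%:E)%E /\
  (ov <= (l * (r2 * (if 0 < D then D else 0)))%:E)%E.
Proof.
move=> r10 r20 l0 s0; cbv zeta; rewrite ysectionI.
have m1 := measurable_hit_section 0 (l, phi) r10.
have m2 := measurable_hit_section th (l, phi) r20.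
case: ifPn => [D0|].
  have := area_hit 0 r10 l0 s0; rewrite subr0 (gtr0_norm s0) => <-.
  have := area_hit th r20 l0 s0; rewrite (gtr0_norm D0) => <-.
  by split; apply: le_measure; rewrite ?inE//; exact: measurableI.
rewrite -leNgt le_eqVlt => D0; rewrite !mulr0.
suff -> : area (ysection (hit r1 0) (l, phi) `&` ysection (hit r2 th) (l, phi)) = 0%E by [].
case/predU1P : D0 => D0.
  apply/eqP; rewrite eq_le measure_ge0 andbT -(area_hit_parallel r20 l0 s0 D0).
  by apply: le_measure; rewrite ?inE//; exact: measurableI.
apply: (area_sheared_line0 (k := cot phi)); first exact: measurableI.
move=> x y [].
rewrite /ysection/= !inE => /sheared_hit -/(_ s0); rewrite subr0.
move=> /(_ (lt0r_neq0 s0))[/andP[+ _] _]; rewrite subr0 pmulr_rge0// => x0.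
move=> /sheared_hit -/(_ s0 (ltr0_neq0 D0))[/andP[+ _] _].
by rewrite nmulr_rge0// => x1; apply/eqP; rewrite eq_le x0 x1.
Qed.

End hit_area.

(** * Integrals over the orientation *)

Section interval_integrals.
Variable R : realType.
Local Notation leb := (@lebesgue_measure R).
Implicit Types (a b c x th : R).

Lemma integral_is_derive (f F : R -> R) a b : a <= b ->
  (forall x, is_derive x 1 F (f x)) -> continuous f ->
  (\int[leb]_(x in `[a, b]) (f x)%:E = (F b - F a)%:E)%E.
Proof.
rewrite le_eqVlt => /predU1P[<- _ _|ab dF cf].
  by rewrite set_itv1 integral_set1 subrr.
have dF1 x : derivable F x 1 by have [] := dF x.
have cF x : F @ x --> F x by apply: differentiable_continuous; exact/derivable1_diffP.
rewrite (@continuous_FTC2 _ f F)//.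
- exact: continuous_subspaceT.
- split => [x _||] //.
  + by apply: cvg_at_right_filter; exact: cF.
  + by apply: cvg_at_left_filter; exact: cF.
- by move=> x _; rewrite derive1E; have [] := dF x.
Qed.

Lemma ge0_integral_itv_split (f : R -> \bar R) a b c : a <= b -> b <= c ->
  measurable_fun setT f -> (forall x, 0 <= f x)%E ->
  (\int[leb]_(x in `[a, c]) f x =
   \int[leb]_(x in `[a, b]) f x + \int[leb]_(x in `[b, c]) f x)%E.
Proof.
move=> ab bc mf f0.
have mfD D : measurable D -> measurable_fun D f by move=> mD; exact: measurable_funTS.
rewrite -(integral_itv_bndo_bndc (a := BLeft a) (r := b)); last exact: mfD.
rewrite -ge0_integral_setU//; last 2 first.
- by apply: mfD; exact: measurableU.
- apply/disj_setPS => x [] /=; rewrite !in_itv/= => /andP[_ xb] /andP[bx _].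
  by move: xb; rewrite ltNge bx.
congr (integral _ _ _); apply/seteqP; split=> x /=; rewrite !in_itv/=.
  by move=> /andP[ax xc]; have [xb|bx] := ltP x b; [left|right]; apply/andP.
case=> /andP[h1 h2]; apply/andP; split => //.
  by apply: le_trans bc; exact: ltW.
exact: le_trans ab h1.
Qed.

Lemma integral_sinB_right a : a <= pi ->
  (\int[leb]_(x in `[a, pi]) (sin (x - a))%:E = (1 + cos a)%:E)%E.
Proof.
move=> api; have -> : 1 + cos a = - cos (pi - a) - - cos (a - a).
  by rewrite cosB cospi sinpi subrr cos0; ring.
apply: (@integral_is_derive (fun x => sin (x - a)) (fun x => - cos (x - a)) a pi api).
- by move=> x; apply: is_derive_eq; rewrite /GRing.scale/=; ring.
- by move=> x; apply: continuous_comp; [|exact: continuous_sin];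
    apply: cvgB; [exact: cvg_id|exact: cvg_cst].
Qed.

Lemma integral_sinB_left a : 0 <= a ->
  (\int[leb]_(x in `[0%R, a]) (sin (a - x))%:E = (1 - cos a)%:E)%E.
Proof.
move=> a0; have -> : 1 - cos a = cos (a - a) - cos (a - 0) by rewrite subrr cos0 subr0.
apply: (@integral_is_derive (fun x => sin (a - x)) (fun x => cos (a - x)) 0 a a0).
- by move=> x; apply: is_derive_eq; rewrite /GRing.scale/=; ring.
- by move=> x; apply: continuous_comp; [|exact: continuous_sin];
    apply: cvgB; [exact: cvg_cst|exact: cvg_id].
Qed.

Lemma integral_sin a b : a <= b ->
  (\int[leb]_(x in `[a, b]) (sin x)%:E = (cos a - cos b)%:E)%E.
Proof.
move=> ab; have -> : cos a - cos b = - cos b - - cos a by ring.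
apply: (@integral_is_derive sin (fun x => - cos x) a b ab).
- by move=> x; apply: is_derive_eq; rewrite ?opprK.
- exact: continuous_sin.
Qed.

(** Reversing the second link by a half turn only changes signs, which reduces [th] beyond [pi] to
    an angle in [[0, pi]]. *)
Lemma sin_shift_pi th : pi <= th <= 2 * pi -> exists2 a : R, 0 <= a <= pi &
  (forall x, sin (x - th) = - sin (x - a)) /\ cos th = - cos a.
Proof.
move=> /andP[th1 th2]; exists (th - pi).
  by apply/andP; split; [rewrite subr_ge0|rewrite lerBlDr -mulr2n -mulr_natl].
split=> [x|]; last by rewrite cosB cospi sinpi; ring.
by rewrite opprB addrA [X in _ = - sin X](_ : _ = x - th + pi) ?sinDpi ?opprK//; ring.
Qed.

Lemma sinB_le0 a x : 0 <= a <= pi -> x \in `[0, a] -> sin (x - a) <= 0.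
Proof.
move=> /andP[a0 api]; rewrite in_itv/= => /andP[x0 xa].
rewrite -oppr_ge0 -sinN opprB; apply: sin_ge0_pi.
by apply/andP; split; lra.
Qed.

Lemma sinB_ge0 a x : 0 <= a <= pi -> x \in `[a, pi] -> 0 <= sin (x - a).
Proof.
move=> /andP[a0 api]; rewrite in_itv/= => /andP[x0 xa].
by apply: sin_ge0_pi; apply/andP; split; lra.
Qed.

Lemma measurable_sinB a : measurable_fun setT (fun x : R => sin (x - a)).
Proof. by apply: (measurableT_comp (@measurable_sin R)); exact: measurable_funB. Qed.

Lemma integral_abs_sin th : 0 <= th <= 2 * pi ->
  (\int[leb]_(x in `[0%R, pi]) `|sin (x - th)|%:E = 2%:E)%E.
Proof.
wlog thpi : th / th <= pi.
  move=> H /andP[th0 th2]; have [thpi|pith] := leP th pi; first by apply: H => //; apply/andP.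
  have [|a /andP[a0 api] [sE _]] := @sin_shift_pi th; first by rewrite ltW.
  rewrite -(H a)//; last by rewrite a0 (le_trans api)// ler_peMl ?pi_ge0// ler1n.
  by apply: eq_integral => x _; rewrite sE normrN.
move=> /andP[th0 _]; have th0pi : 0 <= th <= pi by apply/andP.
rewrite (ge0_integral_itv_split th0 thpi)//; last first.
  by apply/measurable_EFinP/measurableT_comp => //; exact: measurable_sinB.
rewrite [X in (X + _)%E](_ : _ = (1 - cos th)%:E); last first.
  rewrite -integral_sinB_left//; apply: eq_integral => x; rewrite inE.
  by move=> /(sinB_le0 th0pi) ?; rewrite ler0_norm// -sinN opprB.
rewrite [X in (_ + X)%E](_ : _ = (1 + cos th)%:E); last first.
  rewrite -integral_sinB_right//; apply: eq_integral => x; rewrite inE.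
  by move=> /(sinB_ge0 th0pi) ?; rewrite ger0_norm.
by rewrite -EFinD; congr EFin; ring.
Qed.

Lemma integral_half_le (f u v : R -> R) th K :
  0 <= th <= pi -> measurable_fun setT f -> (forall x, 0 <= f x) ->
  {in `[0, th], forall x, f x <= u x} -> {in `[th, pi], forall x, f x <= v x} ->
  measurable_fun setT u -> measurable_fun setT v ->
  (\int[leb]_(x in `[0%R, th]) (u x)%:E + \int[leb]_(x in `[th, pi]) (v x)%:E = K%:E)%E ->
  (\int[leb]_(x in `[0%R, pi]) (f x)%:E <= K%:E)%E.
Proof.
move=> /andP[th0 thpi] mf f0 fu fv mu mv <-.
rewrite (ge0_integral_itv_split th0 thpi)//; last exact/measurable_EFinP.
apply: leeD; apply: ge0_le_integral => //.
- by move=> x _; rewrite lee_fin.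
- by apply: measurable_funTS; exact/measurable_EFinP.
- by apply: measurable_funTS; exact/measurable_EFinP.
- by move=> x _; rewrite lee_fin.
- by apply: measurable_funTS; exact/measurable_EFinP.
- by apply: measurable_funTS; exact/measurable_EFinP.
Qed.

Lemma measurable_if_gt0 (f g : R -> R) : measurable_fun setT f -> measurable_fun setT g ->
  measurable_fun setT (fun x => if 0 < f x then g x else 0).
Proof.
by move=> mf mg; apply: measurable_fun_ifT => //; exact: measurable_fun_ltr.
Qed.

(** The width of the first link across a blockage of orientation [x], counted only when both links
    are on the same side. The absolute value, which equals [sin x] on [[0, pi]], keeps the function
    nonnegative on the whole line. *)
Definition overlap1 th x : R := if 0 < sin (x - th) then `|sin x| else 0.

Definition overlap2 th x : R := if 0 < sin (x - th) then sin (x - th) else 0.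

Lemma measurable_overlap1 th : measurable_fun setT (overlap1 th).
Proof.
apply: measurable_if_gt0; first exact: measurable_sinB.
by apply: measurableT_comp => //; exact: measurable_sin.
Qed.

Lemma measurable_overlap2 th : measurable_fun setT (overlap2 th).
Proof. by apply: measurable_if_gt0; exact: measurable_sinB. Qed.

(** For [th <= pi] only orientations in [[th, pi]] contribute, and the sine integrates to
    [1 + cos th]. Beyond [pi] only those in [[0, a]] with [a = th - pi] do, giving [1 - cos a], the
    same value. *)
Lemma integral_overlap1_le th : 0 <= th <= 2 * pi ->
  (\int[leb]_(x in `[0%R, pi]) (overlap1 th x)%:E <= (1 + cos th)%:E)%E.
Proof.
move=> /andP[th0 th2].
have ov0 x : 0 <= overlap1 th x by rewrite /overlap1; case: ifP.
have mov := measurable_overlap1 th.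
have sin_norm a b x : 0 <= a -> b <= pi -> x \in `[a, b] -> `|sin x| <= sin x.
  rewrite in_itv/= => a0 bpi /andP[ax xb].
  by rewrite ger0_norm// sin_ge0_pi// (le_trans a0)//= (le_trans xb).
have [thpi|/ltW pith] := leP th pi.
  have th0pi : 0 <= th <= pi by apply/andP.
  apply: (@integral_half_le _ (cst 0) sin th) => //.
  - by move=> x /(sinB_le0 th0pi); rewrite /overlap1 ltNge => ->.
  - move=> x xth; rewrite /overlap1; case: ifP => _; first exact: (@sin_norm th pi).
    by apply: le_trans (@sin_norm th pi x _ _ xth).
  - exact: measurable_sin.
  - by rewrite integral_sin// integral0 add0e cospi opprK addrC.
have [//|a a0pi [sE ->]] := @sin_shift_pi th; first by rewrite pith.
have /andP[a0 api] := a0pi.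
apply: (@integral_half_le _ sin (cst 0) a) => //.
- move=> x xa; rewrite /overlap1; case: ifP => _; first exact: (@sin_norm 0 a).
  by apply: le_trans (@sin_norm 0 a x _ _ xa).
- by move=> x /(sinB_ge0 a0pi); rewrite /overlap1 sE oppr_gt0 ltNge => ->.
- exact: measurable_sin.
- by rewrite integral_sin// integral0 adde0 cos0.
Qed.

Lemma integral_overlap2_le th : 0 <= th <= 2 * pi ->
  (\int[leb]_(x in `[0%R, pi]) (overlap2 th x)%:E <= (1 + cos th)%:E)%E.
Proof.
move=> /andP[th0 th2].
have ov0 x : 0 <= overlap2 th x by rewrite /overlap2; case: ltP => // /ltW.
have mov := measurable_overlap2 th.
have [thpi|/ltW pith] := leP th pi.
  have th0pi : 0 <= th <= pi by apply/andP.
  apply: (@integral_half_le _ (cst 0) (fun x => sin (x - th)) th) => //.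
  - by move=> x /(sinB_le0 th0pi); rewrite /overlap2 ltNge => ->.
  - by move=> x /(sinB_ge0 th0pi); rewrite /overlap2; case: ifP.
  - exact: measurable_sinB.
  - by rewrite integral_sinB_right// integral0 add0e.
have [//|a a0pi [sE ->]] := @sin_shift_pi th; first by rewrite pith.
have /andP[a0 api] := a0pi.
apply: (@integral_half_le _ (fun x => sin (a - x)) (cst 0) a) => //.
- move=> x /(sinB_le0 a0pi) s0; rewrite /overlap2 sE -sinN opprB.
  by case: ifP => // _; rewrite -(opprB x a) sinN oppr_ge0.
- by move=> x /(sinB_ge0 a0pi); rewrite /overlap2 sE oppr_gt0 ltNge => ->.
- rewrite (_ : (fun x => _) = (fun x => - sin (x - a))); last first.
    by apply/funext => x; rewrite -sinN opprB.
  by apply: measurable_funN; exact: measurable_sinB.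
- by rewrite integral_sinB_left// integral0 adde0.
Qed.

End interval_integrals.

(** * Line-of-sight probabilities *)

Section area_sigma_finite.
Variable R : realType.
Local Notation leb := (@lebesgue_measure R).

Lemma sigma_finite_area : sigma_finite setT (leb \x leb)%E.
Proof.
pose I (n : nat) : set (measurableTypeR R) := `[- n%:R, n%:R]%classic.
exists (fun n => I n `*` I n) => [|n].
  apply/esym; rewrite -subTset => -[x y] _.
  exists (maxn (Num.bound `|x|) (Num.bound `|y|)) => //.
  split; rewrite /I/= in_itv/= -ler_norml; apply: ltW.
    by apply: lt_le_trans (archi_boundP _) _ => //; rewrite ler_nat leq_maxl.
  by apply: lt_le_trans (archi_boundP _) _ => //; rewrite ler_nat leq_maxr.
split; first by apply: measurableX; exact: measurable_itv.
have lI : (leb (I n) \is a fin_num) by rewrite /I lebesgue_measure_itv; case: ifP.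
rewrite product_measure1E; [|exact: measurable_itv|exact: measurable_itv].
apply: lte_mul_pinfty; [exact: measure_ge0|exact: lI|].
by move: lI; rewrite ge0_fin_numE.
Qed.

(** A named copy of the area that carries the sigma-finite structure, required for exchanging it
    with the law of the marks. *)
Definition area_fun : set (measurableTypeR R * measurableTypeR R)%type -> \bar R :=
  (leb \x leb)%E.

HB.instance Definition _ := Measure.on area_fun.

HB.instance Definition _ :=
  Measure_isSigmaFinite.Build _ _ _ area_fun sigma_finite_area.

Definition area_measure :
  {sigma_finite_measure set (measurableTypeR R * measurableTypeR R)%type -> \bar R} :=
  area_fun.

End area_sigma_finite.

Section boolean_los.
Variables (R : realType) (E : boolean_model R).
Local Notation P := (bm_prob E).
Local Notation leb := (@lebesgue_measure R).
Local Notation len0 := (bm_length E 0%N).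
Implicit Types (G : set ((R * R) * (R * R))) (F : R * R -> \bar R).

Definition angle_law : probability R R := distribution P (bm_angle E 0%N).

(** Lengths and angles are separate families in the model; taking the product of their laws puts the
    product rule of [bm_indep] in the form expected by [marked_void_prob]. *)
Definition mark_law : probability (R * R)%type R :=
  (distribution P len0 \x angle_law)%E.

(* Lebesgue measure lives on the copy [measurableTypeR R] of [R], with another
   display; this map changes the display. *)
Let toTR : R -> measurableTypeR R := id.

Let measurable_toTR : measurable_fun setT toTR.
Proof. by move=> _ Y mY; rewrite setTI. Qed.

Lemma angle_law_integral (f : R -> \bar R) : measurable_fun setT f ->
  (forall x, 0 <= f x)%E ->
  (\int[angle_law]_phi f phi = pi^-1%:E * \int[leb]_(phi in `[0%R, pi]) f phi)%E.
Proof.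
move=> mf f0.
have mf' : measurable_fun setT (f : measurableTypeR R -> \bar R) by [].
have := integral_uniform (pi_gt0 R) mf' f0; rewrite subr0 => <-.
have := ge0_integral_pushforward measurable_toTR angle_law measurableT mf' (fun x _ => f0 x).
rewrite preimage_setT => <-; apply: eq_measure_integral => A mA _.
exact: (@bm_angle_unif R E 0%N A mA).
Qed.

Definition mean_length : R := fine 'E_P[len0]%E.

Lemma mean_lengthE : 'E_P[len0]%E = mean_length%:E.
Proof.
have /andP[h1 h2] := @bm_length_mean R E.
by rewrite fineK// ge0_fin_numE// ltW.
Qed.

Lemma mean_length_gt0 : 0 < mean_length.
Proof. by have /andP[+ _] := @bm_length_mean R E; rewrite mean_lengthE. Qed.

Lemma mark_law_rect (B C : set R) i : measurable B -> measurable C ->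
  mark_law (B `*` C) = (P (bm_length E i @^-1` B) * P (bm_angle E i @^-1` C))%E.
Proof.
move=> mB mC; rewrite [LHS]product_measure1E//.
congr (_ * _)%E; first by rewrite -[LHS](@bm_length_id R E i B mB).
by rewrite [LHS](@bm_angle_unif R E 0%N C mC) -[LHS](@bm_angle_unif R E i C mC).
Qed.

Lemma mark_law_indep (n : nat) (A : 'I_n -> set (R * R)) (B C : 'I_n -> set R) :
  (forall i, measurable (A i)) -> (forall i, measurable (B i)) ->
  (forall i, measurable (C i)) ->
  P [set w | forall i : 'I_n, [/\ A i (bm_center E i w),
                     B i (bm_length E i w) & C i (bm_angle E i w)]] =
  (P [set w | forall i : 'I_n, A i (bm_center E i w)] *
   \prod_(i < n) mark_law (B i `*` C i))%E.
Proof.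
move=> mA mB mC; rewrite (@bm_indep R E n A B C mA mB mC); congr (_ * _)%E.
by apply: eq_bigr => i _; rewrite (mark_law_rect i).
Qed.

Lemma measurable_angle_integral F : measurable_fun setT F ->
  (forall m, 0 <= F m)%E ->
  measurable_fun setT (fun w => \int[angle_law]_phi F (len0 w, phi))%E.
Proof.
move=> mF F0.
have mG : measurable_fun setT (fun l => \int[angle_law]_phi F (l, phi))%E.
  exact: (measurable_fun_fubini_tonelli_F (m2 := angle_law) F mF F0).
exact: (measurableT_comp mG (measurable_funPT len0)).
Qed.

Lemma mark_law_integral F : measurable_fun setT F -> (forall m, 0 <= F m)%E ->
  (\int[mark_law]_m F m = \int[P]_w \int[angle_law]_phi F (len0 w, phi))%E.
Proof.
move=> mF F0; rewrite [LHS]fubini_tonelli1//=.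
rewrite ge0_integral_distribution//.
- exact: measurable_fun_fubini_tonelli_F.
- by move=> l; apply: integral_ge0.
Qed.

Let toTR2 : measurableTypeR R * measurableTypeR R -> R * R := id.

Let measurable_toTR2 : measurable_fun setT toTR2.
Proof. by move=> _ Y mY; rewrite setTI. Qed.

Definition center_intensity : {measure set (R * R) -> \bar R} :=
  mscale (NngNum (ltW (@bm_mu_gt0 R E))) (image_measure (leb \x leb)%E measurable_toTR2).

Lemma center_intensity_poisson : is_poisson_process center_intensity (bm_center E).
Proof. exact: (@bm_centerP R E). Qed.

(** Fubini: integrating the mark probability over the centers is averaging, over the marks, the area
    of the centers that block. *)
Lemma blocking_intensity G : measurable G ->
  (\int[center_intensity]_c mark_law (xsection G c) =
   (bm_mu E)%:E * \int[mark_law]_m area (ysection G m))%E.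
Proof.
move=> mG; rewrite ge0_integral_mscale//; last exact: measurable_fun_xsection.
congr (_ * _)%E.
rewrite [LHS](ge0_integral_pushforward measurable_toTR2)//=; last first.
  exact: (measurable_fun_xsection mark_law mG).
transitivity (((leb \x leb) \x mark_law) G)%E; first by [].
transitivity (((leb \x leb) \x^ mark_law) G)%E; last by [].
exact: (@product_measure12 R _ _ _ _ (area_measure R) mark_law G mG).
Qed.

Lemma void_prob G : measurable G ->
  (\int[mark_law]_m area (ysection G m) < +oo)%E ->
  let N := [set w | forall i, ~ G (bm_center E i w, (bm_length E i w, bm_angle E i w))] in
  measurable N /\
  P N = (expR (- (bm_mu E * fine (\int[mark_law]_m area (ysection G m)))))%:E.
Proof.
move=> mG Goo; cbv zeta.
have i0 : (0 <= \int[mark_law]_m area (ysection G m))%E.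
  by apply: integral_ge0 => m _; exact: measure_ge0.
have [|mN ->] := marked_void_prob center_intensity_poisson mark_law_indep mG.
  by rewrite blocking_intensity// lte_mul_pinfty ?lee_fin ?ltW ?bm_mu_gt0.
by split => //; rewrite blocking_intensity// fineM// ge0_fin_numE.
Qed.

Section mark_integral.
Variables (F : R * R -> \bar R) (a : R -> R) (K : R).
Hypotheses (mF : measurable_fun setT F) (F0 : forall m, (0 <= F m)%E).
Hypotheses (ma : measurable_fun setT a) (a0 : forall x, 0 <= a x).

Let mFl l : measurable_fun setT (fun phi => F (l, phi)).
Proof. by apply: (measurableT_comp mF); exact: measurable_pair1. Qed.

(** The endpoints are null, and at them [sin phi = 0], so that shearing by the cotangent breaks
    down. *)
Let open_angle (f : R -> \bar R) : measurable_fun setT f ->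
  (\int[leb]_(phi in `[0%R, pi]) f phi = \int[leb]_(phi in `]0%R, pi[) f phi)%E.
Proof. by move=> mf; apply: integral_itv_bndoo; exact: measurable_funTS. Qed.

Let scaled l : 0 <= l -> (\int[leb]_(phi in `]0%R, pi[) ((l * a phi)%:E) =
  l%:E * \int[leb]_(phi in `[0%R, pi]) (a phi)%:E)%E.
Proof.
move=> l0; rewrite -(open_angle (f := fun phi => (l * a phi)%:E)); last first.
  by apply/measurable_EFinP; exact: measurable_funM.
rewrite -ge0_integralZl//.
- by apply: measurable_funTS; exact/measurable_EFinP.
- by move=> x _; rewrite lee_fin.
Qed.

Let meanZ : 0 <= K ->
  (\int[P]_w ((K / pi)%:E * (len0 w)%:E) = (mean_length * (K / pi))%:E)%E.
Proof.
move=> K0; rewrite ge0_integralZl//; last 3 first.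
- by apply/measurable_EFinP; exact: measurable_funPT.
- by move=> w _; rewrite lee_fin; exact: (@bm_length_ge0 R E).
- by rewrite lee_fin divr_ge0// pi_ge0.
by rewrite -expectation_def mean_lengthE -EFinM mulrC.
Qed.

(** The bound is assumed only for nonnegative lengths. The length is therefore integrated over the
    probability space, where nonnegativity holds at every point. The [pi] in [K / pi] is the density
    of the angle. *)
Lemma mark_integral_le :
  (forall l phi : R, 0 <= l -> 0 < phi < pi -> (F (l, phi) <= (l * a phi)%:E)%E) ->
  (\int[leb]_(phi in `[0%R, pi]) (a phi)%:E <= K%:E)%E ->
  (\int[mark_law]_m F m <= (mean_length * (K / pi))%:E)%E.
Proof.
move=> Fa aK; have K0 : 0 <= K.
  by rewrite -lee_fin; apply: le_trans aK; apply: integral_ge0 => x _; rewrite lee_fin.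
rewrite mark_law_integral// -meanZ//; apply: ge0_le_integral => //.
- by move=> w _; exact: integral_ge0.
- exact: measurable_angle_integral.
- by apply: emeasurable_funM => //; apply/measurable_EFinP; exact: measurable_funPT.
move=> w _; have l0 := @bm_length_ge0 R E 0%N w.
rewrite angle_law_integral//.
rewrite mulrC EFinM -muleA lee_pmul2l ?lte_fin ?invr_gt0 ?pi_gt0//.
rewrite open_angle//; apply: le_trans (_ : _ <= (len0 w)%:E * K%:E)%E _; last by rewrite muleC.
apply: (@le_trans _ _ (\int[leb]_(phi in `]0%R, pi[) ((len0 w * a phi)%:E))%E).
  apply: ge0_le_integral => //.
  - by apply: measurable_funTS; exact: mFl.
  - by apply: measurable_funTS; apply/measurable_EFinP; exact: measurable_funM.
  - by move=> phi /=; rewrite in_itv/= => ?; exact: Fa.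
by rewrite scaled// lee_pmul// ?lee_fin//; apply: integral_ge0 => x _; rewrite lee_fin.
Qed.

Lemma mark_integral_eq :
  (forall l phi : R, 0 <= l -> 0 < phi < pi -> F (l, phi) = (l * a phi)%:E) ->
  (\int[leb]_(phi in `[0%R, pi]) (a phi)%:E = K%:E)%E ->
  (\int[mark_law]_m F m = (mean_length * (K / pi))%:E)%E.
Proof.
move=> Fa aK; have K0 : 0 <= K.
  by rewrite -lee_fin -aK; apply: integral_ge0 => x _; rewrite lee_fin.
rewrite mark_law_integral// -meanZ//; apply: eq_integral => w _.
have l0 := @bm_length_ge0 R E 0%N w.
rewrite angle_law_integral// open_angle// mulrC EFinM -muleA; congr (_ * _)%E.
rewrite -aK muleC -scaled//; apply: eq_integral => phi.
by rewrite inE/= in_itv/= => ?; exact: Fa.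
Qed.

End mark_integral.

End boolean_los.

Section los_probabilities.
Variables (R : realType) (E : boolean_model R).
Local Notation P := (bm_prob E).
Local Notation leb := (@lebesgue_measure R).
Implicit Types (r th : R) (G : set ((R * R) * (R * R))).

Lemma losE r th : @los R E r th =
  [set w | forall i, ~ hit r th (bm_center E i w, (bm_length E i w, bm_angle E i w))].
Proof.
apply/seteqP; split=> w /= H i.
  by move=> [z Hz]; have := H i; rewrite -subset0 => /(_ z Hz).
by apply/eqP; apply: contrapT => /negP/set0P; exact: H.
Qed.

Definition blocking_mean G : \bar R := (\int[mark_law E]_m area (ysection G m))%E.

Lemma measurable_area_ysection G : measurable G ->
  measurable_fun setT (fun m => area (ysection G m)).
Proof. by move=> mG; exact: (measurable_fun_ysection (area_measure R) mG). Qed.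

Lemma blocking_mean_hit r th : 0 <= r -> 0 <= th <= 2 * pi ->
  blocking_mean (hit r th) = (mean_length E * (r * 2 / pi))%:E.
Proof.
move=> r0 th0; apply: (@mark_integral_eq R E _ (fun phi => r * `|sin (phi - th)|) (r * 2)).
- by apply: measurable_area_ysection; exact: measurable_hit.
- by move=> m; exact: measure_ge0.
- apply: measurable_funM => //.
  by apply: measurableT_comp => //; exact: measurable_sinB.
- by move=> x; rewrite mulr_ge0.
- by move=> l phi l0 phi0; rewrite area_hit// sin_gt0_pi.
- under eq_integral do rewrite EFinM.
  rewrite ge0_integralZl ?lee_fin//; last first.
    apply: measurable_funTS; apply/measurable_EFinP.
    by apply: measurableT_comp => //; exact: measurable_sinB.
  by rewrite integral_abs_sin.
Qed.

Lemma blocking_mean_overlap r1 r2 th : 0 <= r1 -> 0 <= r2 -> 0 <= th <= 2 * pi ->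
  (blocking_mean (hit r1 0 `&` hit r2 th) <=
   (mean_length E * (Num.min r1 r2 * (1 + cos th) / pi))%:E)%E.
Proof.
move=> r10 r20 th0.
have mG : measurable (hit r1 0 `&` hit r2 th).
  by apply: measurableI; exact: measurable_hit.
have bound r (a : R -> R) : 0 <= r -> measurable_fun setT a -> (forall x, 0 <= a x) ->
    (forall l phi, 0 <= l -> 0 < phi < pi ->
       (area (ysection (hit r1 0 `&` hit r2 th) (l, phi)) <= (l * (r * a phi))%:E)%E) ->
    (\int[leb]_(phi in `[0%R, pi]) (a phi)%:E <= (1 + cos th)%:E)%E ->
    (blocking_mean (hit r1 0 `&` hit r2 th) <=
     (mean_length E * (r * (1 + cos th) / pi))%:E)%E.
  move=> r0 ma a0 ova aK.
  apply: (@mark_integral_le R E _ (fun phi => r * a phi) (r * (1 + cos th))) => //.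
  - exact: measurable_area_ysection.
  - by apply: measurable_funM.
  - by move=> x; rewrite mulr_ge0.
  - under eq_integral do rewrite EFinM.
    rewrite ge0_integralZl ?lee_fin//.
    + by rewrite EFinM lee_pmul// ?lee_fin//; apply: integral_ge0 => x _; rewrite lee_fin.
    + by apply: measurable_funTS; apply/measurable_EFinP.
    + by move=> x _; rewrite lee_fin.
(* The overlap is bounded by the parallelogram of the shorter link; both orientation profiles have
   the same bound [1 + cos th]. *)
have [r12|r21] := leP r1 r2.
  apply: (bound _ (overlap1 th)) => //.
  - exact: measurable_overlap1.
  - by move=> x; rewrite /overlap1; case: ifP.
  - move=> l phi l0 /sin_gt0_pi s0; have [+ _] := area_overlap th r10 r20 l0 s0.
    by rewrite /overlap1 (gtr0_norm s0).
  - exact: integral_overlap1_le.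
apply: (bound _ (overlap2 th)) => //.
- exact: measurable_overlap2.
- by move=> x; rewrite /overlap2; case: ifP => // /ltW.
- move=> l phi l0 /sin_gt0_pi s0; have [_] := area_overlap th r10 r20 l0 s0.
  exact.
- exact: integral_overlap2_le.
Qed.

(** Inclusion-exclusion in additive form, which avoids subtracting extended reals. *)
Lemma blocking_meanU G1 G2 : measurable G1 -> measurable G2 ->
  (blocking_mean (G1 `|` G2) + blocking_mean (G1 `&` G2) =
   blocking_mean G1 + blocking_mean G2)%E.
Proof.
move=> m1 m2; pose f G m := area (ysection G m).
have f0 G m : setT m -> (0 <= f G m)%E by move=> _; exact: measure_ge0.
have intD G G' : measurable G -> measurable G' ->
    (\int[mark_law E]_m (f G m + f G' m) = blocking_mean G + blocking_mean G')%E.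
  move=> mG mG'; exact: (ge0_integralD (mark_law E) measurableT (f0 G)
    (measurable_area_ysection mG) (f0 G') (measurable_area_ysection mG')).
have mU : measurable (G1 `|` G2) by exact: measurableU.
have mI : measurable (G1 `&` G2) by exact: measurableI.
apply: etrans (esym (intD _ _ mU mI)) _; apply: etrans _ (intD _ _ m1 m2).
apply: eq_integral => m _; rewrite /f ysectionI.
have -> : ysection (G1 `|` G2) m = ysection G1 m `|` ysection G2 m.
  by apply/seteqP; split=> x; rewrite /ysection/= !inE.
have [my1 my2] := (measurable_ysection m m1, measurable_ysection m m2).
have -> : ysection G1 m `|` ysection G2 m = (ysection G1 m `\` ysection G2 m) `|` ysection G2 m.
  by rewrite setDE setUIl setUC setvU setIT.
have areaD : area (ysection G1 m) = (area (ysection G1 m `\` ysection G2 m) +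
    area (ysection G1 m `&` ysection G2 m))%E by exact: measureDI.
have areaU : area ((ysection G1 m `\` ysection G2 m) `|` ysection G2 m) =
    (area (ysection G1 m `\` ysection G2 m) + area (ysection G2 m))%E.
  apply: measureU => //; first exact: measurableD.
  by rewrite setDE -setIA setICl setI0.
by rewrite areaU areaD addeAC.
Qed.

Lemma bm_beta_gt0 : 0 < bm_beta E.
Proof.
rewrite /bm_beta -/(mean_length E) divr_gt0 ?pi_gt0// !mulr_gt0 ?mean_length_gt0//.
exact: (@bm_mu_gt0 R E).
Qed.

Lemma los_prob_expR r : 0 <= r -> los_prob E r = expR (- (bm_beta E * r)).
Proof.
move=> r0; rewrite /los_prob losE.
have b := @blocking_mean_hit r 0 r0.
have [|_ ->] := @void_prob R E (hit r 0) (measurable_hit 0 r0).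
  by rewrite -/(blocking_mean _) b ?ltry// lexx mulr_ge0// pi_ge0.
rewrite -/(blocking_mean _) b/=; last by rewrite lexx mulr_ge0// pi_ge0.
congr (expR (- _)); rewrite /bm_beta /mean_length.
have : (pi : R) != 0 by rewrite gt_eqF// pi_gt0.
by move: (pi : R) => p p0; field.
Qed.

Lemma blocking_mean_union r1 r2 th : 0 <= r1 -> 0 <= r2 -> 0 <= th <= 2 * pi ->
  exists U I : R, [/\ blocking_mean (hit r1 0 `|` hit r2 th) = U%:E,
    U + I = mean_length E * (r1 * 2 / pi) + mean_length E * (r2 * 2 / pi), 0 <= I &
    I <= mean_length E * (Num.min r1 r2 * (1 + cos th) / pi)].
Proof.
move=> r10 r20 th0; set G1 := hit r1 0; set G2 := hit r2 th.
have m1 : measurable G1 by exact: measurable_hit.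
have m2 : measurable G2 by exact: measurable_hit.
have b0 G : (0 <= blocking_mean G)%E by apply: integral_ge0 => m _; exact: measure_ge0.
have z0 : 0 <= (0 : R) <= 2 * pi by rewrite lexx mulr_ge0// pi_ge0.
have bI := blocking_mean_overlap r10 r20 th0.
have bIfin : blocking_mean (G1 `&` G2) \is a fin_num.
  by rewrite ge0_fin_numE// (le_lt_trans bI)// ltry.
have bU := blocking_meanU m1 m2.
rewrite (blocking_mean_hit r10 z0) (blocking_mean_hit r20 th0) -EFinD in bU.
have bUfin : blocking_mean (G1 `|` G2) \is a fin_num.
  by rewrite ge0_fin_numE// (@le_lt_trans _ _ (blocking_mean (G1 `|` G2) +
    blocking_mean (G1 `&` G2))%E)// ?leeDl// bU ltry.
rewrite -(fineK bUfin) -(fineK bIfin) -EFinD in bU; case: bU => bU.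
rewrite -(fineK bIfin) lee_fin in bI.
exists (fine (blocking_mean (G1 `|` G2))), (fine (blocking_mean (G1 `&` G2))).
by split; [rewrite fineK|exact: bU|rewrite fine_ge0|exact: bI].
Qed.

(** The exponent is that of independent links plus [bm_mu E * I], with [I] the mean overlap. The
    lower bound is [0 <= I]; the upper one is the bound on [I], whose constant equals half of
    [bm_beta] times the minimum times [1 + cos th]. *)
Lemma joint_los_prob_bounds r1 r2 th : 0 <= r1 -> 0 <= r2 -> 0 <= th <= 2 * pi ->
  indep_joint_los (bm_beta E) r1 r2 th <= joint_los_prob E r1 r2 th
    <= maxcorr_joint_los (bm_beta E) r1 r2 th.
Proof.
move=> r10 r20 th0; have [U [I [bU UI I0 I1]]] := blocking_mean_union r10 r20 th0.
have -> : joint_los_prob E r1 r2 th = expR (- (bm_mu E * U)).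
  rewrite /joint_los_prob.
  have -> : @los R E r1 0 `&` @los R E r2 th = [set w | forall i, ~ (hit r1 0 `|` hit r2 th)
      (bm_center E i w, (bm_length E i w, bm_angle E i w))].
    rewrite !losE; apply/seteqP; split=> w /=.
      by move=> [h1 h2] i [/h1|/h2].
    by move=> h; split=> i H; apply: (h i); [left|right].
  have mU : measurable (hit r1 0 `|` hit r2 th).
    by apply: measurableU; exact: measurable_hit.
  have [|_ ->] := @void_prob R E _ mU; rewrite -/(blocking_mean _) bU//.
  exact: ltry.
rewrite /indep_joint_los /maxcorr_joint_los !ler_expR /bm_beta -/(mean_length E).
move: (mean_length E) (Num.min r1 r2) (cos th) UI I1 => m k c UI I1.
have p0 : (pi : R) != 0 by rewrite gt_eqF// pi_gt0.
have mu0 := @bm_mu_gt0 R E.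
have -> : U = m * (r1 * 2 / pi) + m * (r2 * 2 / pi) - I by rewrite -UI addrK.
have -> : bm_mu E * (m * (r1 * 2 / pi) + m * (r2 * 2 / pi) - I) =
    2 * bm_mu E * m / pi * r1 + 2 * bm_mu E * m / pi * r2 - bm_mu E * I.
  by move: (pi : R) p0 => p p0; field.
have -> : 2^-1 * k * (2 * bm_mu E * m / pi) * (1 + c) = bm_mu E * (m * (k * (1 + c) / pi)).
  by move: (pi : R) p0 => p p0; field.
have := ler_wpM2l (ltW mu0) I1; have := mulr_ge0 (ltW mu0) I0.
move: (pi : R) (m * _) => p q h1 h2.
by apply/andP; split; lra.
Qed.

End los_probabilities.

(** * Coverage *)

Section monotone_integral.
Local Open Scope ereal_scope.

Import HBNNSimple.

(* Unlike the library's [ge0_le_integral], without measurability: the joint LoS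
   probabilities of a model are not known to be measurable functions. *)
Lemma ge0_le_integral_nomeas d (T : measurableType d) (R : realType)
    (mu : {measure set T -> \bar R}) (D : set T) (f g : T -> \bar R) :
  (forall x, D x -> 0 <= f x) -> (forall x, D x -> f x <= g x) ->
  \int[mu]_(x in D) f x <= \int[mu]_(x in D) g x.
Proof.
move=> f0 fg; have g0 x : D x -> 0 <= g x by move=> Dx; exact: le_trans (f0 _ Dx) (fg _ Dx).
rewrite !ge0_integralE//; apply: le_ereal_sup => _ [h /= hf <-].
exists h => //= x; apply: le_trans (hf x) _; rewrite /patch.
by case: ifPn => //; rewrite inE; exact: fg.
Qed.

End monotone_integral.

Section coverage_monotone.
Variables (R : realType) (lam noise tau : R) (ell : R -> R).
Hypotheses (lam_gt0 : 0 < lam) (tau_gt0 : 0 < tau)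
  (ell_gt0 : forall r, 0 <= r -> 0 < ell r).
Variables (pL : R -> R) (pLL1 pLL2 : R -> R -> R -> R).
Hypotheses (pL0 : forall r, 0 <= r -> 0 <= pL r)
  (pLL0 : forall r1 r2 th, 0 <= pLL1 r1 r2 th)
  (pLLle : forall r1 r2 th, 0 <= r1 -> 0 <= r2 -> 0 <= th <= 2 * pi ->
     pLL1 r1 r2 th <= pLL2 r1 r2 th).

Let thinning_ge0 r t : 0 <= r -> 0 <= t -> 0 <= lam / (1 + tau^-1 * (ell r / ell t)).
Proof.
move=> r0 t0; rewrite divr_ge0 ?(ltW lam_gt0)// addr_ge0// mulr_ge0 ?invr_ge0 ?(ltW tau_gt0)//.
by rewrite divr_ge0 ?ltW ?ell_gt0.
Qed.

Lemma serving_g_le x : 0 <= x ->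
  (serving_g lam pL pLL2 x <= serving_g lam pL pLL1 x)%E.
Proof.
move=> x0; rewrite /serving_g lee_wpmul2l ?lee_fin ?pL0// lee_expeR leeN2.
rewrite lee_wpmul2l ?lee_fin ?(ltW lam_gt0)//.
have pos th t : 0 <= t -> (0 <= (pLL1 x t th / pL x * t)%:E)%E.
  by move=> t0; rewrite lee_fin mulr_ge0// divr_ge0 ?pL0.
apply: ge0_le_integral_nomeas => th /=; rewrite in_itv/= => th0.
  by apply: integral_ge0 => t; rewrite /= in_itv/= => /andP[t0 _]; exact: pos.
apply: ge0_le_integral_nomeas => t /=; rewrite in_itv/= => /andP[t0 _]; first exact: pos.
by rewrite lee_fin ler_wpM2r// ler_wpM2r ?invr_ge0 ?pL0// pLLle.
Qed.

Lemma interf_kappa_le r : 0 <= r ->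
  (interf_kappa lam ell pL pLL2 r tau <= interf_kappa lam ell pL pLL1 r tau)%E.
Proof.
move=> r0; rewrite /interf_kappa lee_expeR leeN2.
have int0 t : (0 <= \int[@lebesgue_measure R]_(th in `[0%R, (2 * pi)%R])
    (pLL1 r t th / pL r)%:E)%E.
  by apply: integral_ge0 => th _; rewrite lee_fin divr_ge0 ?pL0.
apply: ge0_le_integral_nomeas => t /=; rewrite in_itv/= andbT => rt;
  have t0 := le_trans r0 rt.
  by rewrite !mule_ge0// ?lee_fin// thinning_ge0.
apply: lee_wpmul2r; first by rewrite lee_fin.
apply: lee_wpmul2l; first by rewrite lee_fin thinning_ge0.
apply: ge0_le_integral_nomeas => th /=; rewrite in_itv/= => th0.
  by rewrite lee_fin divr_ge0 ?pL0.
by rewrite lee_fin ler_wpM2r ?invr_ge0 ?pL0// pLLle.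
Qed.

Lemma coverage_le :
  (coverage lam noise ell pL pLL2 tau <= coverage lam noise ell pL pLL1 tau)%E.
Proof.
have c0 r : (0 <= (2 * pi * lam * expR (- (tau * noise / ell r)))%:E :> \bar R)%E.
  by rewrite lee_fin !mulr_ge0 ?expR_ge0 ?pi_ge0 ?(ltW lam_gt0).
have g0 pLL r : 0 <= r -> (0 <= serving_g lam pL pLL r)%E.
  by move=> r0; rewrite /serving_g mule_ge0 ?lee_fin ?pL0// expeR_ge0.
have k0 pLL r : (0 <= interf_kappa lam ell pL pLL r tau)%E by exact: expeR_ge0.
apply: ge0_le_integral_nomeas => r /=; rewrite in_itv/= andbT => r0.
  apply: mule_ge0; last by rewrite lee_fin.
  by apply: mule_ge0; [exact: mule_ge0|exact: g0].
apply: lee_wpmul2r; first by rewrite lee_fin.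
apply: lee_pmul; [exact: mule_ge0|exact: g0| |exact: serving_g_le].
by apply: lee_wpmul2l => //; exact: interf_kappa_le.
Qed.

End coverage_monotone.

Section coverage_extensional.
Variables (R : realType) (lam noise tau : R) (ell : R -> R).

(** Lets the LoS probabilities of two models with equal [bm_beta] be replaced by one and the same
    function. *)
Lemma eq_coverage (pL pL' : R -> R) (pLL : R -> R -> R -> R) :
  (forall r, 0 <= r -> pL r = pL' r) ->
  coverage lam noise ell pL pLL tau = coverage lam noise ell pL' pLL tau.
Proof.
move=> pLE; apply: eq_integral => r; rewrite inE/= in_itv/= andbT => r0.
by rewrite /serving_g /interf_kappa pLE.
Qed.

Lemma eq_coverage_integral (kappa kappa' g g' : R -> \bar R) :
  (forall r, 0 <= r -> kappa r = kappa' r) -> (forall r, 0 <= r -> g r = g' r) ->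
  coverage_integral lam noise ell tau kappa g =
  coverage_integral lam noise ell tau kappa' g'.
Proof.
move=> kE gE; apply: eq_integral => r; rewrite inE/= in_itv/= andbT => r0.
by rewrite kE// gE.
Qed.

End coverage_extensional.

Section independent_blocking.
Variables (R : realType) (lam tau beta : R) (ell : R -> R) (pL : R -> R).
Hypotheses (beta_gt0 : 0 < beta)
  (pLE : forall r, 0 <= r -> pL r = expR (- (beta * r))).
Local Notation leb := (@lebesgue_measure R).

Lemma integral_t_expR x : 0 <= x ->
  (\int[leb]_(t in `[0%R, x]) (expR (- (beta * t)) * t)%:E =
   ((1 - (1 + beta * x) * expR (- (beta * x))) / beta ^+ 2)%:E)%E.
Proof.
move=> x0; have b0 : beta != 0 by rewrite gt_eqF.
(* An antiderivative of [t * expR (- (beta * t))], found by parts. *)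
pose F t := - ((1 + beta * t) * expR (- (beta * t)) / beta ^+ 2).
have -> : (1 - (1 + beta * x) * expR (- (beta * x))) / beta ^+ 2 = F x - F 0.
  by rewrite /F !mulr0 oppr0 expR0; field.
apply: (@integral_is_derive R (fun t => expR (- (beta * t)) * t) F 0 x x0).
- by move=> t; apply: is_derive_eq; rewrite /GRing.scale/=; field.
- move=> t; apply: cvgM; last exact: cvg_id.
  apply: continuous_comp; last exact: continuous_expR.
  by apply: cvgN; apply: cvgM; [exact: cvg_cst|exact: cvg_id].
Qed.

Lemma integral_angle_cst (c : R) :
  (\int[leb]_(th in `[0%R, (2 * pi)%R]) c%:E = (c * (2 * pi))%:E)%E.
Proof.
rewrite (integral_cst leb)//= lebesgue_measure_itv/= lte_fin mulr_gt0 ?pi_gt0//.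
by rewrite oppr0 adde0 -EFinM.
Qed.

Lemma serving_g_indep x : 0 <= x ->
  serving_g lam pL (indep_joint_los beta) x = g_upper lam beta x.
Proof.
move=> x0; rewrite /serving_g /g_upper.
have inner th : (\int[leb]_(t in `[0%R, x]) (indep_joint_los beta x t th / pL x * t)%:E =
    ((1 - (1 + beta * x) * expR (- (beta * x))) / beta ^+ 2)%:E)%E.
  rewrite -integral_t_expR//; apply: eq_integral => t _.
  by rewrite /indep_joint_los pLE// -expRN -expRD; congr (expR _ * _)%:E; ring.
under eq_integral do rewrite inner.
rewrite integral_angle_cst -EFinM pLE// -expRD; congr (expR _)%:E.
have b0 : beta != 0 by rewrite gt_eqF.
by move: (pi : R) => p; field.
Qed.

Lemma interf_kappa_indep r : 0 <= r ->
  interf_kappa lam ell pL (indep_joint_los beta) r tau =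
  kappa_upper lam beta ell r tau.
Proof.
move=> r0; rewrite /interf_kappa /kappa_upper; congr (expeR (- _)).
apply: eq_integral => t _.
have inner th : indep_joint_los beta r t th / pL r = expR (- (beta * t)).
  by rewrite /indep_joint_los pLE// -expRN -expRD; congr expR; ring.
under eq_integral do rewrite inner.
rewrite integral_angle_cst -!EFinM; congr EFin.
by move: (pi : R) => p; ring.
Qed.

End independent_blocking.

(** * Reduction of angular integrals to a quarter turn *)

Section sin2_integral.
Variable R : realType.
Local Notation leb := (@lebesgue_measure R).
Variable h : R -> R.
Hypotheses (ch : continuous h) (h0 : forall x, 0 <= h x).

Let G (u : R) := h (sin u ^+ 2).

Let cG : continuous G.
Proof.
move=> u; rewrite /G; apply: (@continuous_comp _ _ _ (fun u => sin u ^+ 2) h); last exact: ch.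
by apply: continuousM; exact: continuous_sin.
Qed.

Let mG : measurable_fun setT (EFin \o G).
Proof. by apply/measurable_EFinP; exact: continuous_measurable_fun. Qed.

Lemma integral_sin2_half :
  (\int[leb]_(th in `[0%R, (2 * pi)%R]) (h (sin (th / 2) ^+ 2))%:E =
   2%:E * \int[leb]_(u in `[0%R, pi]) (h (sin u ^+ 2))%:E)%E.
Proof.
pose F (th : R) := th / 2.
have DF : derive1 F = cst 2^-1.
  by apply/funext => z; rewrite derive1E derive_val !scaler0 add0r /GRing.scale/= mulr1.
have cF : continuous F by move=> x; apply: cvgM; [exact: cvg_id|exact: cvg_cst].
have F0 : F 0 = 0 by rewrite /F mul0r.
have Fpi : F (2 * pi) = pi by rewrite /F mulrC mulKf.
have := @integration_by_substitution_increasing R F G 0 (2 * pi).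
rewrite F0 Fpi DF => -> //.
- rewrite -ge0_integralZl//.
  + apply: eq_integral => x _; rewrite -EFinM; congr EFin.
    by rewrite -[RHS]/(2 * (h (sin (x / 2) ^+ 2) * 2^-1)); field.
  + apply: measurable_funTS; apply/measurable_EFinP; apply: measurable_funM => //.
    apply: continuous_measurable_fun => x; apply: continuous_comp; last exact: cG.
    exact: cF.
  + by move=> x _; rewrite lee_fin -[X in 0 <= X]/(h (sin (x / 2) ^+ 2) * 2^-1) mulr_ge0.
- by rewrite mulr_ge0// pi_ge0.
- by move=> x y _ _ xy; rewrite /F ltr_pM2r.
- by move=> x _; exact: cvg_cst.
- exact: is_cvg_cst.
- exact: is_cvg_cst.
- split => [x _||].
  + by rewrite /F; apply: ex_derive.
  + by apply: cvg_at_right_filter; exact: cF.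
  + by apply: cvg_at_left_filter; exact: cF.
- exact: continuous_subspaceT.
Qed.

Lemma integral_sin2_reflect :
  (\int[leb]_(u in `[(pi / 2)%R, pi]) (h (sin u ^+ 2))%:E =
   \int[leb]_(u in `[0%R, (pi / 2)%R]) (h (sin u ^+ 2))%:E)%E.
Proof.
pose F (u : R) := pi - u.
have DF : derive1 F = cst (-1).
  by apply/funext => z; rewrite derive1E derive_val add0r mul1r.
have cF : continuous F by move=> x; apply: cvgB; [exact: cvg_cst|exact: cvg_id].
have F0 : F 0 = pi by rewrite /F subr0.
have Fpi : F (pi / 2) = pi / 2 by rewrite /F; move: (pi : R) => p; field.
have := @integration_by_substitution_decreasing R F G 0 (pi / 2).
rewrite F0 Fpi DF => -> //.
- apply: eq_integral => x _; congr EFin.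
  rewrite -[LHS]/(h (sin (pi - x) ^+ 2) * - (- 1)) opprK mulr1 sinB sinpi cospi.
  by rewrite mul0r sub0r mulN1r opprK.
- by rewrite divr_ge0// pi_ge0.
- by move=> x y _ _ xy; rewrite /F ltrD2l ltrN2.
- by move=> x _; exact: cvg_cst.
- exact: is_cvg_cst.
- exact: is_cvg_cst.
- split => [x _||].
  + by rewrite /F; apply: ex_derive.
  + by apply: cvg_at_right_filter; exact: cF.
  + by apply: cvg_at_left_filter; exact: cF.
- exact: continuous_subspaceT.
Qed.

(** The origin of the 4 and of the range up to [pi / 2] in [g_lower]: halving the angle gives a
    factor 2, and the symmetry of the squared sine about [pi / 2] another. *)
Lemma integral_sin2_quarter :
  (\int[leb]_(th in `[0%R, (2 * pi)%R]) (h (sin (th / 2) ^+ 2))%:E =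
   4%:E * \int[leb]_(u in `[0%R, (pi / 2)%R]) (h (sin u ^+ 2))%:E)%E.
Proof.
have p0 : (0 : R) <= pi / 2 by rewrite divr_ge0// pi_ge0.
have p1 : (pi / 2 : R) <= pi by rewrite ler_pdivrMr// ler_peMr ?pi_ge0// ler1n.
rewrite integral_sin2_half (ge0_integral_itv_split p0 p1)//; last first.
  by move=> x; rewrite lee_fin.
rewrite integral_sin2_reflect.
have -> : 4%:E = (2%:E + 2%:E)%E :> \bar R by rewrite -EFinD; congr EFin; ring.
by rewrite ge0_muleDr ?ge0_muleDl ?lee_fin//; apply: integral_ge0 => x _; rewrite lee_fin.
Qed.

End sin2_integral.

Section fubini_rectangle.
Context d1 d2 (T1 : measurableType d1) (T2 : measurableType d2) (R : realType).
Variables (m1 : {sigma_finite_measure set T1 -> \bar R})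
  (m2 : {sigma_finite_measure set T2 -> \bar R}).
Local Open Scope ereal_scope.

(** Tonelli on the whole product, applied to [f] extended by zero off the rectangle. *)
Lemma fubini_tonelli_rectangle (D1 : set T1) (D2 : set T2) (f : T1 * T2 -> \bar R) :
  measurable D1 -> measurable D2 -> measurable_fun setT f -> (forall z, 0 <= f z) ->
  \int[m1]_(x in D1) \int[m2]_(y in D2) f (x, y) =
  \int[m2]_(y in D2) \int[m1]_(x in D1) f (x, y).
Proof.
move=> mD1 mD2 mf f0.
have mD : measurable (D1 `*` D2) by exact: measurableX.
have mfD : measurable_fun setT (f \_ (D1 `*` D2)).
  by apply: (iffLR (measurable_restrictT f mD)); exact: measurable_funTS.
have fD0 z : 0 <= (f \_ (D1 `*` D2)) z by rewrite /patch; case: ifP.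
have E := fubini_tonelli (m1 := m1) (m2 := m2) _ mfD fD0.
rewrite integral_mkcond [RHS]integral_mkcond.
transitivity (\int[m1]_x \int[m2]_y (f \_ (D1 `*` D2)) (x, y)).
  apply: eq_integral => x _; rewrite /patch; case: ifPn => xD.
    rewrite integral_mkcond; apply: eq_integral => y _.
    by rewrite /patch in_setX xD.
  by rewrite integral0_eq// => y _; rewrite in_setX (negbTE xD).
rewrite E; apply: eq_integral => y _; rewrite /patch; case: ifPn => yD.
  rewrite [RHS]integral_mkcond; apply: eq_integral => x _.
  by rewrite /patch in_setX yD andbT.
by rewrite integral0_eq// => x _; rewrite in_setX (negbTE yD) andbF.
Qed.

Lemma measurable_integral_section (D1 : set T1) (f : T1 * T2 -> \bar R) :
  measurable D1 -> measurable_fun setT f -> (forall z, 0 <= f z) ->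
  measurable_fun setT (fun y => \int[m1]_(x in D1) f (x, y)).
Proof.
move=> mD1 mf f0; have mD : measurable (D1 `*` [set: T2]) by exact: measurableX.
have mfD : measurable_fun setT (f \_ (D1 `*` setT)).
  by apply: (iffLR (measurable_restrictT f mD)); exact: measurable_funTS.
have fD0 z : 0 <= (f \_ (D1 `*` setT)) z by rewrite /patch; case: ifP.
have := measurable_fun_fubini_tonelli_G (m1 := m1) _ mfD fD0.
congr measurable_fun; apply/funext => y; rewrite /fubini_G [RHS]integral_mkcond.
by apply: eq_integral => x _; rewrite /patch in_setX in_setT andbT.
Qed.

End fubini_rectangle.

(** * The Bessel function as an angular integral *)

Section bessel.
Variable R : realType.
Local Notation leb := (@lebesgue_measure R).
Local Notation turn := (`[0%R, (2 * pi)%R]%classic : set R).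
Implicit Types (z x : R) (n m : nat).

Let turn_ge0 : 0 <= 2 * pi :> R.
Proof. by rewrite mulr_ge0// pi_ge0. Qed.

Lemma integrable_turn (f : R -> R) : continuous f ->
  leb.-integrable turn (EFin \o f).
Proof.
move=> cf; apply: continuous_compact_integrable; first exact: segment_compact.
exact: continuous_subspaceT.
Qed.

Lemma continuous_cosX n : continuous (fun x : R => cos x ^+ n).
Proof.
by move=> x; apply: (@continuous_comp _ _ _ cos (fun y : R => y ^+ n));
  [exact: continuous_cos|exact: exprn_continuous].
Qed.

Definition cos_moment n : R := fine (\int[leb]_(x in turn) (cos x ^+ n)%:E)%E.

Lemma cos_momentE n :
  (cos_moment n)%:E = (\int[leb]_(x in turn) (cos x ^+ n)%:E)%E.
Proof.
rewrite /cos_moment fineK//; apply: integrable_fin_num => //.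
exact: integrable_turn (@continuous_cosX n).
Qed.

Lemma cos_moment0 : cos_moment 0 = 2 * pi.
Proof.
apply: EFin_inj; rewrite cos_momentE; under eq_integral do rewrite expr0.
by rewrite integral_angle_cst mul1r.
Qed.

Lemma cos_moment1 : cos_moment 1 = 0.
Proof.
apply: EFin_inj; rewrite cos_momentE; under eq_integral do rewrite expr1.
rewrite (@integral_is_derive R cos sin 0 (2 * pi))//; last exact: continuous_cos.
by rewrite mulr_natl sin2pi sin0 subrr.
Qed.

(** The difference of the two integrands is the derivative of [cos x ^+ n.+1 * sin x], which
    vanishes at both ends of the turn. *)
Lemma cos_momentSS n : n.+2%:R * cos_moment n.+2 = n.+1%:R * cos_moment n.
Proof.
pose F x : R := cos x ^+ n.+1 * sin x.
pose f x : R := n.+2%:R * cos x ^+ n.+2 - n.+1%:R * cos x ^+ n.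
have cf : continuous f.
  move=> x; apply: cvgB; apply: cvgM; try exact: cvg_cst; exact: continuous_cosX.
have fE : (\int[leb]_(x in turn) (f x)%:E = (F (2 * pi) - F 0)%:E)%E.
  apply: (@integral_is_derive R f F) => // x.
  have -> : F = cos ^+ n.+1 * sin by apply/funext => y; rewrite /F !fctE.
  apply: (is_derive_eq (is_deriveM (is_deriveX n.+1 (is_derive_cos x)) (is_derive_sin x))).
  rewrite exprfctE /f /GRing.scale/=.
  have s2 : sin x * sin x = 1 - cos x * cos x.
    by rewrite -!expr2 -(cos2Dsin2 x) addrC addKr.
  transitivity (cos x ^+ n.+1 * cos x - n.+1%:R * cos x ^+ n * (sin x * sin x)).
    by ring.
  by rewrite s2 -[n.+2%:R]natr1 !exprS; ring.
have scale m (c : R) : leb.-integrable turn (EFin \o (fun x => c * cos x ^+ m)).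
  by apply: integrable_turn => x; apply: cvgM; [exact: cvg_cst|exact: continuous_cosX].
have /eqP : \int[leb]_(x in turn) f x = 0.
  by rewrite /Rintegral fE /F mulr_natl sin2pi sin0 !mulr0 subrr.
rewrite /f RintegralB// !RintegralZl//; last 2 first.
- exact: integrable_turn (@continuous_cosX n).
- exact: integrable_turn (@continuous_cosX n.+2).
by rewrite subr_eq0 => /eqP.
Qed.

Lemma cos_moment_even k :
  cos_moment (2 * k) / (2 * k)`!%:R = 2 * pi / (2 ^+ (2 * k) * (k`!%:R ^+ 2)).
Proof.
elim: k => [|k IH]; first by rewrite muln0 cos_moment0 !fact0 expr0 expr1n mulr1.
have -> : (2 * k.+1 = (2 * k).+2)%N by rewrite mulnS.
have W2 : cos_moment (2 * k).+2 = (2 * k).+1%:R * cos_moment (2 * k) / (2 * k).+2%:R.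
  by rewrite -cos_momentSS [_%:R * _]mulrC mulfK// pnatr_eq0.
rewrite W2 !factS !natrM.
have -> : (2 * k).+2%:R = 2 * k.+1%:R :> R by rewrite -natrM mulnS.
have f1 : (2 * k)`!%:R != 0 :> R by rewrite pnatr_eq0 -lt0n fact_gt0.
have f2 : k`!%:R != 0 :> R by rewrite pnatr_eq0 -lt0n fact_gt0.
have k1 : k.+1%:R != 0 :> R by rewrite pnatr_eq0.
have k2 : (2 * k).+1%:R != 0 :> R by rewrite pnatr_eq0.
have p2 : 2 ^+ (2 * k) != 0 :> R by rewrite expf_neq0.
transitivity (cos_moment (2 * k) / (2 * k)`!%:R / (4 * k.+1%:R ^+ 2)).
  move: (cos_moment _) ((2 * k)`!%:R : R) (k.+1%:R : R) ((2 * k).+1%:R : R) f1 k1 k2.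
  by move=> W a m u a0 m0 u0; field; rewrite a0 m0 u0.
rewrite IH !exprS.
move: (2 ^+ _) (k`!%:R : R) (k.+1%:R : R) (pi : R) p2 f2 k1.
by move=> p a m q p0 a0 m0; field; rewrite p0 a0 m0.
Qed.

Lemma cos_moment_odd k : cos_moment (2 * k).+1 = 0.
Proof.
elim: k => [|k IH]; first exact: cos_moment1.
have -> : (2 * k.+1 = (2 * k).+2)%N by rewrite mulnS.
have := cos_momentSS (2 * k).+1; rewrite IH mulr0 => /eqP.
by rewrite mulf_eq0 pnatr_eq0 => /eqP.
Qed.

(** The exponential series is integrated term by term under the bound [expR |z|]. Convergence of the
    Bessel series is not shown separately: its partial sums are integrals already known to
    converge. *)
Lemma integral_expR_cos z :
  (\int[leb]_(x in turn) (expR (z * cos x))%:E = (2 * pi * bessel_I0 z)%:E)%E.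
Proof.
pose S N x : R := series (exp_coeff (z * cos x)) N.
have S0 x : S 0%N x = 0 by rewrite /S /series/= big_geq.
have SS N x : S N.+1 x = S N x + z ^+ N / N`!%:R * cos x ^+ N.
  by rewrite /S seriesSr /exp_coeff/= exprMn; congr (_ + _); ring.
have cS N : continuous (S N).
  elim: N => [|N IH]; first by rewrite (funext S0); exact: cst_continuous.
  rewrite (funext (SS N)) => x; apply: cvgD; first exact: IH.
  by apply: cvgM; [exact: cvg_cst|exact: continuous_cosX].
pose s N := \sum_(k < N) z ^+ k / k`!%:R * cos_moment k.
have iS N : leb.-integrable turn (EFin \o S N) by exact: integrable_turn (cS N).
have intS N : (\int[leb]_(x in turn) (S N x)%:E = (s N)%:E)%E.
  rewrite -[LHS]fineK; last by apply: integrable_fin_num => //; exact: iS.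
  congr EFin; rewrite -[LHS]/(\int[leb]_(x in turn) S N x) /s.
  elim: N => [|N IH].
    by rewrite big_ord0 (funext S0) /Rintegral integral0.
  rewrite big_ord_recr/= -IH (funext (SS N)) RintegralD//.
    congr (_ + _); apply: RintegralZl => //.
    exact: integrable_turn (@continuous_cosX N).
  by apply: integrable_turn => x; apply: cvgM; [exact: cvg_cst|exact: continuous_cosX].
have Sle N x : `|S N x| <= expR `|z|.
  apply: (@le_trans _ _ (series (exp_coeff `|z|) N)).
    rewrite /S /series/=; apply: le_trans (ler_norm_sum _ _ _) _.
    apply: ler_sum => k _; rewrite /exp_coeff/= normrM normrX normrM normfV normr_nat.
    rewrite ler_wpM2r ?invr_ge0// lerXn2r ?nnegrE ?mulr_ge0//.
    by rewrite ler_piMr// cos_max.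
  apply: nondecreasing_cvgn_le; last exact: is_cvg_series_exp_coeff.
  by apply: nondecreasing_series => k _ _; exact: exp_coeff_ge0.
have cE : continuous (fun x => expR (z * cos x)).
  move=> x; apply: (@continuous_comp _ _ _ (fun x => z * cos x) expR); last exact: continuous_expR.
  by apply: cvgM; [exact: cvg_cst|exact: continuous_cos].
have cvgS : (\int[leb]_(x in turn) (S N x)%:E)%E @[N --> \oo] -->
    (\int[leb]_(x in turn) (expR (z * cos x))%:E)%E.
  apply: (@dominated_cvg _ _ _ leb turn _ (fun N x => (S N x)%:E)
    (fun x => (expR (z * cos x))%:E) (cst (expR `|z|)%:E)) => //.
  - by move=> N; exact: measurable_int (iS N).
  - move=> x _; apply: cvg_EFin; first exact: nearW.
    exact: (is_cvg_series_exp_coeff (z * cos x)).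
  - exact: (integrable_turn (f := cst (expR `|z|)) (@cst_continuous _ _ _)).
  - by move=> N x _; rewrite /= lee_fin.
(* Odd moments vanish, so the first [2 * M] exponential terms leave exactly [M] Bessel terms. *)
have sE M : s (2 * M)%N =
    2 * pi * series (fun k => (z / 2) ^+ (2 * k) / (k`!%:R ^+ 2)) M.
  elim: M => [|M IH]; first by rewrite /s muln0 big_ord0 /series/= big_geq// mulr0.
  rewrite seriesSr mulrDr -IH /s mulnS !addSn add0n !big_ord_recr/= cos_moment_odd mulr0 addr0.
  congr (_ + _); rewrite mulrAC -mulrA cos_moment_even expr_div_n.
  have f2 : M`!%:R != 0 :> R by rewrite pnatr_eq0 -lt0n fact_gt0.
  have p2 : 2 ^+ (2 * M) != 0 :> R by rewrite expf_neq0.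
  move: (2 ^+ _) (z ^+ _) (M`!%:R : R) (pi : R) p2 f2.
  by move=> p y a q p0 a0; field; rewrite p0 a0.
pose J := fine (\int[leb]_(x in turn) (expR (z * cos x))%:E)%E.
have JE : (\int[leb]_(x in turn) (expR (z * cos x))%:E)%E = J%:E.
  by rewrite fineK//; apply: integrable_fin_num => //; exact: integrable_turn.
have cvgs : s N @[N --> \oo] --> J.
  by move: cvgS; rewrite JE; under eq_cvg do rewrite intS; move/fine_cvg.
have cvgs2 : s (2 * M)%N @[M --> \oo] --> J.
  apply: (@cvg_comp _ _ _ (muln 2) s _ _ _ _ cvgs); exact: cvg_mulnl.
have p0 : 2 * pi != 0 :> R by rewrite mulf_neq0// gt_eqF// pi_gt0.
suff -> : bessel_I0 z = J / (2 * pi) by rewrite JE mulrC divfK.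
apply/cvg_lim => //.
rewrite (_ : series _ = fun M => s (2 * M)%N / (2 * pi)).
  by apply: cvgM => //; exact: cvg_cst.
by apply/funext => M; rewrite sE [2 * pi * _]mulrC mulfK.
Qed.

End bessel.

(** * Closed forms in the maximally correlated case *)

Section maximal_correlation.
Variables (R : realType) (lam tau beta : R) (ell : R -> R) (pL : R -> R).
Hypotheses (lam_gt0 : 0 < lam) (tau_gt0 : 0 < tau) (beta_gt0 : 0 < beta)
  (ell_gt0 : forall r, 0 <= r -> 0 < ell r)
  (ell_nonincr : forall r s, 0 <= r -> r <= s -> ell s <= ell r)
  (pLE : forall r, 0 <= r -> pL r = expR (- (beta * r))).
Local Notation leb := (@lebesgue_measure R).

Lemma one_plus_cos (x : R) : 1 + cos x = 2 - 2 * sin (x / 2) ^+ 2.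
Proof.
have -> : cos x = 1 - 2 * sin (x / 2) ^+ 2.
  rewrite -{1}(_ : x / 2 *+ 2 = x); last by rewrite -mulr_natr divfK.
  by rewrite cos_mulr2n cos2sin2; ring.
by ring.
Qed.

(** Here [t <= x], so the minimum is [t]; after division by [pL x] the exponent collapses to
    [- beta * t * sin (th / 2) ^+ 2] by the half-angle formula. *)
Lemma serving_g_maxcorr x : 0 <= x ->
  serving_g lam pL (maxcorr_joint_los beta) x = g_lower lam beta x.
Proof.
move=> x0; rewrite /serving_g /g_lower pLE//; congr (_ * expeR (- _))%E.
(* The absolute value makes the kernel nonnegative on the whole plane, as Tonelli requires; on the
   domain of integration it equals [t]. *)
pose K (z : R * R) : \bar R := (`|z.2| * expR (- (beta * z.2 * sin (z.1 / 2) ^+ 2)))%:E.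
pose K2 (z : R * R) : \bar R := (`|z.2| * expR (- (beta * z.2 * sin z.1 ^+ 2)))%:E.
have K0 z : (0 <= K z)%E by rewrite lee_fin mulr_ge0// expR_ge0.
have K20 z : (0 <= K2 z)%E by rewrite lee_fin mulr_ge0// expR_ge0.
have mexp (u : R * R -> R) : measurable_fun setT u ->
    measurable_fun setT (fun z : R * R => (`|z.2| * expR (- (beta * z.2 * u z)))%:E).
  move=> mu; apply/measurable_EFinP; apply: measurable_funM.
    by apply: measurableT_comp => //; exact: measurable_snd.
  apply: (measurableT_comp (@measurable_expR R)); apply: measurable_funN.
  apply: measurable_funM => //; apply: measurable_funM => //; exact: measurable_snd.
have mK : measurable_fun setT K.
  apply: mexp; apply: measurable_funX; apply: (measurableT_comp (@measurable_sin R)).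
  by apply: measurable_funM => //; exact: measurable_fst.
have mK2 : measurable_fun setT K2.
  apply: mexp; apply: measurable_funX; apply: (measurableT_comp (@measurable_sin R)).
  exact: measurable_fst.
transitivity (lam%:E * \int[leb]_(th in `[0%R, (2 * pi)%R])
    \int[leb]_(t in `[0%R, x]) K (th, t))%E.
  congr (_ * _)%E; apply: eq_integral => th _; apply: eq_integral => t.
  rewrite inE/= in_itv/= => /andP[t0 tx]; rewrite /K/= ger0_norm//.
  rewrite /maxcorr_joint_los -expRN -expRD mulrC; congr (_ * expR _)%:E.
  by rewrite (min_idPr tx) one_plus_cos; field.
have FT : (\int[leb]_(th in `[0%R, (2 * pi)%R]) \int[leb]_(t in `[0%R, x]) K (th, t) =
    \int[leb]_(t in `[0%R, x]) \int[leb]_(th in `[0%R, (2 * pi)%R]) K (th, t))%E.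
  by apply: (@fubini_tonelli_rectangle _ _ _ _ R leb leb _ _ K _ _ mK K0);
    exact: measurable_itv.
rewrite {}FT.
transitivity (lam%:E * \int[leb]_(t in `[0%R, x])
    (4%:E * \int[leb]_(th in `[0%R, (pi / 2)%R]) K2 (th, t)))%E.
  congr (_ * _)%E; apply: eq_integral => t _.
  apply: (@integral_sin2_quarter R (fun v => `|t| * expR (- (beta * t * v)))).
  - move=> v; apply: cvgM; first exact: cvg_cst.
    apply: (@continuous_comp _ _ _ (fun v => - (beta * t * v)) expR); last exact: continuous_expR.
    by apply: cvgN; apply: cvgM; [exact: cvg_cst|exact: cvg_id].
  - by move=> v; rewrite mulr_ge0// expR_ge0.
rewrite ge0_integralZl//; last 2 first.
- by apply: measurable_funTS; exact: (measurable_integral_section leb _ mK2 K20).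
- by move=> t _; apply: integral_ge0 => th _; exact: K20.
rewrite muleA -EFinM mulrC; congr (_ * _)%E.
apply: eq_integral => t; rewrite inE/= in_itv/= => /andP[t0 tx].
by apply: eq_integral => th _; rewrite /K2/= ger0_norm.
Qed.

Lemma bessel_I0_ge0 z : 0 <= bessel_I0 z :> R.
Proof.
have : (0 <= \int[leb]_(x in `[0%R, (2 * pi)%R]) (expR (z * cos x))%:E)%E.
  by apply: integral_ge0 => x _; rewrite lee_fin expR_ge0.
by rewrite integral_expR_cos lee_fin pmulr_rge0// mulr_gt0// pi_gt0.
Qed.

(** Measurability comes from monotonicity alone. As [ell] is controlled only on the nonnegative
    reals, its argument is cut off at 0, which gives a function nonincreasing on the whole line. *)
Lemma measurable_thinning (r : R) : 0 <= r ->
  measurable_fun (`[r, +oo[%classic : set R) (fun t => lam / (1 + tau^-1 * (ell r / ell t))).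
Proof.
move=> r0; pose psi t := lam / (1 + tau^-1 * (ell r / ell (Num.max t 0))).
have pos t : 0 < ell (Num.max t 0) by apply: ell_gt0; rewrite le_max lexx orbT.
have den t : 0 < 1 + tau^-1 * (ell r / ell (Num.max t 0)).
  by rewrite ltr_wpDr// mulr_ge0 ?invr_ge0 ?(ltW tau_gt0)// divr_ge0// ltW// ell_gt0.
have mpsi : measurable_fun setT psi.
  apply: nonincreasing_measurable => // s t st.
  rewrite /psi ler_wpM2l ?(ltW lam_gt0)// lef_pV2 ?posrE// lerD2l.
  rewrite ler_wpM2l ?invr_ge0 ?(ltW tau_gt0)// ler_wpM2l ?(ltW (ell_gt0 r0))//.
  rewrite lef_pV2 ?posrE//; apply: ell_nonincr; first by rewrite le_max lexx orbT.
  by rewrite ge_max le_max st/= le_max lexx orbT.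
apply: (eq_measurable_fun psi); last exact: measurable_funTS.
move=> t; rewrite inE/= in_itv/= andbT => rt.
by rewrite /psi max_l// (le_trans r0).
Qed.

(** Here [t >= r], so the minimum is [r] and the correlation factor depends on the angle only:
    [expR (beta * r / 2)] comes out, and the rest integrates to the Bessel function at
    [beta * r / 2]. *)
Lemma interf_kappa_maxcorr r : 0 <= r ->
  interf_kappa lam ell pL (maxcorr_joint_los beta) r tau =
  kappa_lower lam beta ell r tau.
Proof.
move=> r0; rewrite /interf_kappa /kappa_lower; congr (expeR (- _)).
set C := 2 * pi * expR (beta * r / 2) * bessel_I0 (beta * r / 2).
have C0 : 0 <= C by rewrite !mulr_ge0 ?pi_ge0 ?expR_ge0 ?bessel_I0_ge0.
have thin0 t : 0 <= t -> 0 <= lam / (1 + tau^-1 * (ell r / ell t)).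
  move=> t0; rewrite divr_ge0 ?(ltW lam_gt0)// addr_ge0// mulr_ge0 ?invr_ge0 ?(ltW tau_gt0)//.
  by rewrite divr_ge0 ?ltW ?ell_gt0.
rewrite -ge0_integralZl ?lee_fin//; last 2 first.
- apply/measurable_EFinP; apply: measurable_funM => //.
  apply: (eq_measurable_fun (fun t => lam / (1 + tau^-1 * (ell r / ell t)) * expR (- (beta * t)))).
    by move=> t _; ring.
  apply: measurable_funM; first exact: measurable_thinning.
  apply: measurable_funTS; apply: (measurableT_comp (@measurable_expR R)).
  by apply: measurable_funN; exact: measurable_funM.
- move=> t; rewrite /= in_itv/= andbT => rt; have t0 := le_trans r0 rt.
  by rewrite lee_fin mulr_ge0// mulrAC mulr_ge0 ?expR_ge0 ?thin0.
apply: eq_integral => t; rewrite inE/= in_itv/= andbT => rt.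
have inner : (\int[leb]_(th in `[0%R, (2 * pi)%R])
    (maxcorr_joint_los beta r t th / pL r)%:E = (expR (- (beta * t)) * C)%:E)%E.
  transitivity (\int[leb]_(th in `[0%R, (2 * pi)%R])
      ((expR (- (beta * t)) * expR (beta * r / 2))%:E *
       (expR (beta * r / 2 * cos th))%:E))%E.
    apply: eq_integral => th _; rewrite -EFinM; congr EFin.
    rewrite /maxcorr_joint_los pLE// -expRN -!expRD; congr expR.
    by rewrite (min_idPl rt); field.
  rewrite ge0_integralZl ?lee_fin ?mulr_ge0 ?expR_ge0//; last first.
    apply: measurable_funTS; apply/measurable_EFinP.
    apply: (measurableT_comp (@measurable_expR R)); apply: measurable_funM => //.
    exact: measurable_cos.
  rewrite integral_expR_cos -EFinM /C; congr EFin.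
  by move: (pi : R) => p; ring.
rewrite inner -!EFinM; congr EFin.
by move: C {C0 inner} => C; ring.
Qed.

End maximal_correlation.
Theorem theorem6 (R : realType) (lam noise tau : R) (ell : R -> R)
  (lam_gt0 : 0 < lam) (noise_gt0 : 0 < noise) (tau_gt0 : 0 < tau)
  (ell_gt0 : forall r : R, 0 <= r -> 0 < ell r)
  (ell_bounded : exists M : R, forall r : R, 0 <= r -> ell r <= M)
  (ell_nonincr : forall r s : R, 0 <= r -> r <= s -> ell s <= ell r) :
  (forall E1 E2 : boolean_model R,
     bm_beta E1 = bm_beta E2 ->
     (forall r1 r2 th : R, 0 <= r1 -> 0 <= r2 -> 0 <= th <= 2 * pi ->
        joint_los_prob E1 r1 r2 th <= joint_los_prob E2 r1 r2 th) ->
     (network_coverage lam noise ell E2 tau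
        <= network_coverage lam noise ell E1 tau)%E) /\
  (forall E : boolean_model R,
     let beta := bm_beta E in
     [/\ (coverage_lower lam noise beta ell tau
            <= network_coverage lam noise ell E tau)%E,
         (network_coverage lam noise ell E tau
            <= coverage_upper lam noise beta ell tau)%E,
         coverage lam noise ell (los_prob E) (indep_joint_los beta) tau
           = coverage_upper lam noise beta ell tau &
         coverage lam noise ell (los_prob E) (maxcorr_joint_los beta) tau
           = coverage_lower lam noise beta ell tau]).
Proof.
pose pL beta r : R := expR (- (beta * r)).
have pL0 beta r : 0 <= r -> 0 <= pL beta r by move=> _; exact: expR_ge0.
have losE E r : 0 <= r -> los_prob E r = pL (bm_beta E) r by exact: los_prob_expR.
have joint0 E r1 r2 th : 0 <= joint_los_prob E r1 r2 th.
  by rewrite /joint_los_prob fine_ge0// measure_ge0.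
split=> [E1 E2 beta12 joint12|E beta].
  (* Equal [bm_beta] gives both models the same single-link probability, so they differ only in the
     joint one. *)
  rewrite /network_coverage (eq_coverage lam noise tau ell _ (losE E1)).
  rewrite (eq_coverage lam noise tau ell _ (losE E2)) beta12.
  by apply: coverage_le => // r; exact: pL0.
have beta_gt0 : 0 < beta := bm_beta_gt0 E.
have upperE : coverage lam noise ell (los_prob E) (indep_joint_los beta) tau =
    coverage_upper lam noise beta ell tau.
  by apply: eq_coverage_integral => r r0;
    [exact: interf_kappa_indep (losE E) _ r0|exact: serving_g_indep (losE E) _ r0].
have lowerE : coverage lam noise ell (los_prob E) (maxcorr_joint_los beta) tau =
    coverage_lower lam noise beta ell tau.
  by apply: eq_coverage_integral => r r0;
    [apply: interf_kappa_maxcorr => //|apply: serving_g_maxcorr => //]; exact: losE.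
have los0 r : 0 <= r -> 0 <= los_prob E r by move=> r0; rewrite losE// pL0.
(* Written as coverages of the two extreme joint probabilities, both bounds become instances of
   [coverage_le]. *)
split; [rewrite -lowerE|rewrite -upperE|exact: upperE|exact: lowerE].
- apply: coverage_le => // r1 r2 th r10 r20 th0.
  by have /andP[] := joint_los_prob_bounds E r10 r20 th0.
- apply: coverage_le => // [r1 r2 th|r1 r2 th r10 r20 th0]; first exact: expR_ge0.
  by have /andP[] := joint_los_prob_bounds E r10 r20 th0.
Qed.
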